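(* Let $d=3q$ with $q\in\mathbb{Z}^{+}$ and let $\nu\geq1$ be an integer. Then $$\mu_{A_\nu}(d)\ \ge\ \left(\frac{d(d+3)}{6}-1\right)\Big\lfloor\frac{d}{\nu+1}\Big\rfloor+\left(\frac{d(d-3)}{3}+1\right)\Big\lfloor\frac{d-1}{\nu}\Big\rfloor .$$
   Context: $\mu_{A_\nu}(d)$ denotes the maximal number of singularities of type $A_\nu$ that a surface of degree $d$ in the complex projective space $\mathbb{P}^3(\mathbb{C})$ can have (a singularity is of type $A_\nu$ if it is locally analytically equivalent to $x^2+y^2+z^{\nu+1}=0$ at the origin; the surface may have other singularities as well). *)

(* Defs.v *)
From HB Require Import structures.
From mathcomp Require Import all_boot all_order all_algebra.
From mathcomp Require Import all_classical all_reals all_analysis.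
From mathcomp.real_closed Require Import complex.
(* The notations of mpoly clash with those of all_analysis. *)
From mathcomp.multinomials Require Import -(notations) mpoly.

Set Implicit Arguments.
Unset Strict Implicit.
Unset Printing Implicit Defensive.

Import Order.TTheory GRing.Theory Num.Theory.
Import numFieldNormedType.Exports.

Local Open Scope classical_set_scope.
Local Open Scope ring_scope.

(* Viewing R[i] as a bare numFieldType gives it, and the spaces 'rV_n over it,
   the topology of the complex modulus; differentiability over this field is
   then complex differentiability. *)
Definition Cplx (R : realType) : numFieldType := R[i].

(* Points of P^3(C) are the lines through the origin of C^4. *)
Definition proj3 (R : realType) : choiceType :=
  {L : {vspace 'rV[Cplx R]_4} | \dim L == 1%N}.

Notation form4 R := (mpoly 4 (Cplx R)).

Definition evalform (R : realType) (f : form4 R) (v : 'rV[Cplx R]_4) : Cplx R :=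
  meval (fun k => v 0 k) f.

Definition squarefree_form (R : realType) (f : form4 R) : Prop :=
  forall g h : form4 R, f = g ^+ 2 * h ->
    exists c : Cplx R, g = mpolyC 4 c.

(* The equations of the surfaces of degree d in P^3(C). They are reduced, so
   that d is also the degree of the zero locus; the zero locus may be
   reducible. *)
Definition surface (R : realType) (d : nat) : set (form4 R) :=
  [set f | [/\ f != 0, f \is ishomog1 d mdeg & squarefree_form f]].

(* The affine chart {v_i = 1}: insert the coordinate 1 in position i. *)
Definition chart (R : realType) (i : 'I_4) (x : 'rV[Cplx R]_3) :
    'rV[Cplx R]_4 :=
  \row_k (if unlift i k is Some j then x 0 j else 1).

Definition holomorphic_at (R : realType) (W : normedModType (Cplx R))
    (f : 'rV[Cplx R]_3 -> W) (a : 'rV[Cplx R]_3) : Prop :=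
  \forall x \near a, differentiable f x.

(* Local analytic equivalence of the hypersurface germs (F = 0, a) and
   (G = 0, b): a biholomorphic germ phi (with inverse psi) from b to a carries
   the equation F to G up to a holomorphic unit. *)
Definition analytically_equivalent (R : realType)
    (F : 'rV[Cplx R]_3 -> Cplx R) (a : 'rV[Cplx R]_3)
    (G : 'rV[Cplx R]_3 -> Cplx R) (b : 'rV[Cplx R]_3) : Prop :=
  exists phi psi : 'rV[Cplx R]_3 -> 'rV[Cplx R]_3,
  exists u : 'rV[Cplx R]_3 -> (Cplx R)^o,
  [/\ phi b = a,
      holomorphic_at phi b /\ holomorphic_at psi a,
      (\forall x \near b, psi (phi x) = x) /\
        (\forall y \near a, phi (psi y) = y),
      holomorphic_at u b /\ u b != 0
    & \forall x \near b, F (phi x) = u x * G x].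

Definition A_normal_form (R : realType) (nu : nat) (x : 'rV[Cplx R]_3) :
    Cplx R :=
  x 0 0 ^+ 2 + x 0 1 ^+ 2 + x 0 2 ^+ nu.+1.

Definition A_singularities (R : realType) (nu : nat) (f : form4 R) :
    set (proj3 R) :=
  [set P | exists (i : 'I_4) (a : 'rV[Cplx R]_3),
     val P = <[chart i a]>%VS /\
     analytically_equivalent (fun x => evalform f (chart i x)) a
       (A_normal_form nu) 0].

(* The counting measure of a set is its cardinality, +oo if it is infinite.
   The maximum of these numbers is written as a supremum in \bar R, so that no
   boundedness has to be shown first; a bounded nonempty set of natural numbers
   attains its supremum. *)
Definition mu_A (R : realType) (nu d : nat) : \bar R :=
  ereal_sup [set counting (@A_singularities R nu f) | f in @surface R d].

(* Main.v *)
Require Import Defs.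
From mathcomp Require Import all_boot all_order all_algebra.
From mathcomp Require Import all_classical all_reals all_analysis.
From mathcomp Require Import finmap ring zify lra separable.
From mathcomp.real_closed Require Import complex.
From mathcomp.multinomials Require Import -(notations) mpoly.

Set Implicit Arguments.
Unset Strict Implicit.
Unset Printing Implicit Defensive.

Import Order.TTheory GRing.Theory Num.Theory.
Import numFieldNormedType.Exports.

Local Open Scope classical_set_scope.
Local Open Scope ring_scope.

(** The surfaces are [f(x, y) + 2 + g(z) = 0] in an affine chart, where [f] is a
    folding polynomial of degree [d] with critical values [-2] and [-3], and [g]
    is a polynomial of degree at most [d] that takes the values [0] and [1] with
    multiplicity [nu + 1] as often as possible. At a point where [f] has a
    nondegenerate critical point of value [-2] and [g] has a zero of
    multiplicity [nu + 1], or [f] has one of value [-3] and [g - 1] has a zero of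
    multiplicity [nu + 1], the surface has a singularity of type [A_nu].

    The polynomial [f]. Let [w] be a primitive cube root of unity and let
    [p(x, y)] be the power sum [u1^d + u2^d + u3^d] as a polynomial in the
    elementary symmetric functions [x = u1 + u2 + u3] and
    [y = u1 u2 + u1 u3 + u2 u3], for [u1 u2 u3 = 1]. Put
    [f(x, y) = w p(x, y) + w^2 p(y, x)]. In terms of [U_i = w u_i^d], whose
    product is [1],
      [f + 2 = (1 + U1) (1 + U2) (1 + U3)],
      [f + 3 = (1 + U1 + U1 U2) (1 + 1 / U1 + 1 / (U1 U2))].
    Hence [f] has nondegenerate critical points of value [-2] where two of the
    [U_i] are [-1], and of value [-3] where all the [U_i] are the same primitive
    cube root of unity, as long as the [u_i] are distinct, so that [u1] and [u2]
    are local coordinates of the plane. Since [3] divides [d], there are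
    [d (d - 1) / 2] points of the first kind ([black_torus_points]) and
    [d (d - 3) / 3 + 1] of the second kind ([white_torus_points]).

    The polynomial [g] ([two_value_polynomial]). With [k = floor (d / (nu + 1))]
    points over [0] one can prescribe [floor ((d - 1) / nu) - k] points over [1].
    The conditions are polynomial equations for the coefficients of the factors
    of [g] and [g - 1]; they have a useless solution, at which all the roots
    coincide, but there is one equation less than there are unknowns, so that
    there is another solution ([second_common_zero]). This last fact, the
    elementary case of Krull's height theorem, is deduced from the
    Nullstellensatz ([nullstellensatz]) by counting monomials.

    The normal form. The factorizations above show that the local equation is
    [A B + (z - p)^(nu + 1) Q(z)] with [Q(p)] nonzero and with [A], [B], [z - p]
    vanishing at the point with independent derivatives. A linear combination of
    [A / Q] and [B] gives the coordinates of the normal form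
    ([node_equivalence]); that these are coordinates, and that [u1], [u2] are, is
    the inverse function theorem for holomorphic maps ([local_inverse]).

    The number of singularities is then at least
    [d (d - 1) / 2 * k + (d (d - 3) / 3 + 1) (floor ((d - 1) / nu) - k)], which is
    the bound. *)

(** * The Nullstellensatz over an uncountable field *)

Definition is_ideal (A : comNzRingType) (I : set A) : Prop :=
  [/\ I 0, forall x y, I x -> I y -> I (x + y) & forall a x, I x -> I (a * x)].

Section Ideals.
Variables (A : comNzRingType).
Implicit Types (I J : set A) (s : A).

Lemma ideal_sum I (T : Type) (r : seq T) (P : pred T) (F : T -> A) :
  is_ideal I -> (forall i, P i -> I (F i)) -> I (\sum_(i <- r | P i) F i).
Proof. by case=> I0 ID _ IF; elim/big_ind: _ => //. Qed.

Lemma idealN I x : is_ideal I -> I x -> I (- x).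
Proof. by case=> _ _ IM Ix; rewrite -mulN1r; apply: IM. Qed.

Definition avoids_powers s I := forall e, ~ I (s ^+ e).

(** A maximal element, by Zorn's lemma, of the ideals that contain [J] and no
    power of [s]: for [x] outside it, the ideal generated by adding [x] contains
    a power of [s]. *)
Lemma maximal_avoiding_ideal J s : is_ideal J -> avoids_powers s J ->
  exists M, [/\ is_ideal M, J `<=` M, avoids_powers s M &
    forall x, ~ M x -> exists q e, M (q * x - s ^+ e)].
Proof.
move=> idJ avJ.
pose good I := [/\ is_ideal I, J `<=` I & avoids_powers s I].
have goodJ : good J by split.
(* The empty set is added to the family, being the union of the empty chain. *)
have /Zorn_bigcup [M [goodM maxM]] (F : set (set A)) :
    F `<=` [set I | I = set0 \/ good I] -> total_on F subset ->
    [set I | I = set0 \/ good I] (\bigcup_(I in F) I).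
  move=> FP tot.
  have [[I0 [FI0 gI0]]|none] := pselect (exists I, F I /\ good I); last first.
    left; rewrite -subset0 => x [I FI Ix].
    by case: (FP _ FI) => [I0|gI]; [rewrite I0 in Ix|case: none; exists I].
  right; have [[I00 _ _] JI0 _] := gI0.
  have goodx I x : F I -> I x -> good I.
    by move=> FI Ix; case: (FP _ FI) => // I0'; rewrite I0' in Ix.
  split; [split|by move=> x /JI0 ?; exists I0|].
  - by exists I0.
  - move=> x y [I1 F1 x1] [I2 F2 y2].
    have [[_ D1 _] _ _] := goodx _ _ F1 x1; have [[_ D2 _] _ _] := goodx _ _ F2 y2.
    case: (tot _ _ F1 F2) => sub.
      by exists I2 => //; apply: D2 => //; apply: sub.
    by exists I1 => //; apply: D1 => //; apply: sub.
  - move=> a x [I1 F1 x1]; exists I1 => //.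
    by have [[_ _ M1] _ _] := goodx _ _ F1 x1; apply: M1.
  - by move=> e [I1 F1 x1]; have [_ _ /(_ e)] := goodx _ _ F1 x1.
have {goodM} [idM JM avM] : good M.
  case: goodM => // M0; case: (maxM J) => //; last by right.
  by rewrite M0; split=> // /(_ 0); apply; case: idJ.
exists M; split=> // x Mx; have [M0 MD MM] := idM.
pose I := [set y | exists q m, M m /\ y = m + q * x].
have idI : is_ideal I.
  split.
  - by exists 0, 0; rewrite mul0r addr0.
  - move=> _ _ [q [m [Mm ->]]] [q' [m' [Mm' ->]]].
    by exists (q + q'), (m + m'); split; [apply: MD|rewrite mulrDl addrACA].
  - move=> a _ [q [m [Mm ->]]].
    by exists (a * q), (a * m); split; [apply: MM|rewrite mulrDr mulrA].
have MI : M `<=` I by move=> m Mm; exists 0, m; rewrite mul0r addr0.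
have Ix : I x by exists 1, 0; rewrite mul1r add0r.
have [[e]|nav] := pselect (exists e, I (s ^+ e)).
  move=> [q [m [Mm E]]]; exists q, e; rewrite E opprD addrCA addrA.
  by rewrite addrK -[- m]addr0; case: idM => *; rewrite addr0; apply: idealN.
case: (maxM I); last first.
  by right; split=> //; [move=> y /JM /MI|move=> e Ie; apply: nav; exists e].
by split=> // IM; apply: Mx; apply: IM.
Qed.

End Ideals.

Lemma wide_matrix_kernel (F : fieldType) (m l : nat) (M : 'M[F]_(m, l)) :
  (l < m)%N -> exists2 c : 'rV_m, c != 0 & c *m M = 0.
Proof.
move=> lm; have /rowV0Pn [c cK c0] : kermx M != 0.
  by rewrite kermx_eq0 neq_ltn (leq_ltn_trans (rank_leq_col M)).
by exists c => //; apply/sub_kermxP.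
Qed.

Lemma span_dependent (F : fieldType) (V : lmodType F) (l m : nat)
    (b : 'I_l -> V) (v : 'I_m -> V) (M : 'M[F]_(m, l)) : (l < m)%N ->
  (forall i, v i = \sum_j M i j *: b j) ->
  exists2 c : 'rV_m, c != 0 & \sum_i c 0 i *: v i = 0.
Proof.
move=> /(wide_matrix_kernel M) [c c0 cM] vE; exists c => //.
under eq_bigr do rewrite vE scaler_sumr.
rewrite exchange_big big1 //= => j _.
under eq_bigr do rewrite scalerA.
rewrite -scaler_suml; have -> : \sum_i c 0 i * M i j = (c *m M) 0 j by rewrite mxE.
by rewrite cM mxE scale0r.
Qed.

Section Nullstellensatz.
Variables (K : closedFieldType) (n : nat).
Hypothesis uncK : ~ countable [set: K].
Local Notation A := (mpoly n K).
Local Notation var i := (mpolyX K (mnm1 i) : A).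

Lemma infinite_fibre (rho : K -> nat) :
  exists k, infinite_set (rho @^-1` [set k]).
Proof.
apply: contrapT => /forallNP fin; apply: uncK.
have -> : [set: K] = \bigcup_k (rho @^-1` [set k]).
  by apply/seteqP; split=> // x _; exists (rho x).
apply: bigcup_countable => [|k _]; first exact: countableP.
apply: finite_set_countable.
exact: contrapT (fin k).
Qed.

Lemma mpoly_sub_meval_ideal (M : set A) (a : 'I_n -> K) : is_ideal M ->
  (forall i, M (var i - mpolyC n (a i))) ->
  forall p, M (p - mpolyC n (meval a p)).
Proof.
move=> idM; have [M0 MD MM] := idM => Ma.
have prod p q u v : M (p - u) -> M (q - v) -> M (p * q - u * v).
  move=> Mp Mq; have -> : p * q - u * v = q * (p - u) + u * (q - v).
    by rewrite !mulrBr (mulrC q u) (mulrC q p) addrA subrK.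
  by apply: MD; apply: MM.
have mono (m : multinom n) : M (mpolyX K m - mpolyC n (meval a (mpolyX K m))).
  rewrite mpolyXE_id rmorph_prod rmorph_prod /=.
  elim/big_ind2: _; first by rewrite subrr.
    by move=> x1 y1 x2 y2; apply: prod.
  move=> i _; rewrite !rmorphXn /=; elim: (m i) => [|k IH].
    by rewrite !expr0 subrr.
  by rewrite !exprS; apply: prod => //; rewrite mevalXU; apply: Ma.
elim/mpolyind=> [|c m p _ _ IH]; first by rewrite meval0 mpolyC0 subr0.
rewrite mevalD mevalZ mpolyCD mpolyCM opprD addrACA; apply: MD => //.
by rewrite -mul_mpolyC -mulrBr; apply: MM.
Qed.

(** Over an uncountable algebraically closed field, if no power of [s] lies in
    the ideal [J], then [J] has a zero at which [s] does not vanish. In an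
    ideal [M] containing [J], maximal among those avoiding the powers of [s],
    every variable is congruent to a constant: otherwise all the elements
    [x_i - a] would be invertible up to powers of [s]; uncountably many of the
    inverses would lie in the same finite-dimensional space, and a linear
    relation between them would give a nonzero polynomial in [x_i] alone that
    belongs to [M]. *)
Theorem nullstellensatz (J : set A) (s : A) : is_ideal J ->
  avoids_powers s J ->
  exists2 a : 'I_n -> K, (forall p, J p -> meval a p = 0) & meval a s != 0.
Proof.
move=> idJ /(maximal_avoiding_ideal idJ) [M [idM JM avM maxM]].
have [_ MD MM] := idM.
have M1 : ~ M 1 by move=> M1; apply: (avM 0).
have prime x y : M (x * y) -> M x \/ M y.
  move=> Mxy; apply: contrapT => /not_orP [/maxM [q [e Mq]] /maxM [r [f Mr]]].
  apply: (avM (e + f)); rewrite exprD.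
  rewrite (_ : s ^+ e * s ^+ f = q * r * (x * y) -
    (s ^+ e * (r * y - s ^+ f) + r * y * (q * x - s ^+ e))); last by ring.
  apply: (MD); first exact: MM.
  by apply: idealN => //; apply: MD; apply: MM.
have invar i : exists a, M (var i - mpolyC n a).
  apply: contrapT => /forallNP noa.
  (* The inverses of the x_i - a, up to powers of s, sorted by their degree and
     by the exponent of s. *)
  have /choice [qe qeP] a : exists qe : A * nat,
      M (qe.1 * (var i - mpolyC n a) - s ^+ qe.2).
    by have [q [e ?]] := maxM _ (noa a); exists (q, e).
  have [k infk] := infinite_fibre
    (fun a => choice.pickle (mmeasure mdeg (qe a).1, (qe a).2)).
  pose D := (odflt (0, 0)%N (choice.unpickle k)).1.
  pose e := (odflt (0, 0)%N (choice.unpickle k)).2.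
  pose L := #|{: bmultinom n D}|.
  have [B Bk sB] := infinite_set_fset L.+1 infk.
  pose a (j : 'I_L.+1) := nth 0 B j.
  have aB j : a j \in B by rewrite mem_nth // (leq_trans (ltn_ord j)).
  have aI : injective a.
    move=> i1 i2 /eqP; rewrite nth_uniq ?(leq_trans (ltn_ord _)) ?fset_uniq //.
    by move=> /eqP /val_inj.
  have De j : (mmeasure mdeg (qe (a j)).1, (qe (a j)).2) = (D, e).
    have /= kE := Bk _ (aB j).
    by rewrite /D /e -[k in RHS]kE choice.pickleK.
  pose q j := (qe (a j)).1.
  pose mon (t : 'I_L) : A := mpolyX K (bmnm (enum_val t)).
  have qE j : q j = \sum_t (\matrix_(i1, t) mcoeff (bmnm (enum_val t)) (q i1)) j t *: mon t.
    have [sq _] := De j; rewrite {1}(@mpolywE _ _ D (q j)) ?sq //.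
    rewrite (reindex (@enum_val (bmultinom n D) predT)) /=; last first.
      by apply: onW_bij; apply: enum_val_bij.
    by apply: eq_bigr => t _; rewrite mxE.
  have [c c0 cq] := span_dependent (ltnSn L) qE.
  (* Clearing denominators in the relation between the inverses; h is not zero,
     because its value at a j is a nonzero multiple of c 0 j. *)
  pose h := \sum_j c 0 j *: \prod_(l | l != j) ('X - (a l)%:P).
  have h0 : h != 0.
    have /rV0Pn [j cj] := c0.
    apply: contraNneq cj => h0; have := congr1 (fun p => p.[a j]) h0.
    rewrite horner0 horner_sum (bigD1 j) //= [X in _ + X]big1 ?addr0; last first.
      move=> l lj; rewrite hornerZ horner_prod (bigD1 j) 1?eq_sym //=.
      by rewrite hornerXsubC subrr mul0r mulr0.
    rewrite hornerZ horner_prod => /eqP; rewrite mulf_eq0 => /orP[//|].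
    rewrite prodf_seq_eq0 => /hasP [l _ /andP[ln]].
    by rewrite hornerXsubC subr_eq0 => /eqP /aI E; rewrite E eqxx in ln.
  pose ev (p : {poly K}) : A := (map_poly (@mpolyC n K) p).[var i].
  have evX x : ev ('X - x%:P) = var i - mpolyC n x.
    by rewrite /ev rmorphB /= map_polyX map_polyC hornerXsubC.
  have evM p r : ev (p * r) = ev p * ev r by rewrite /ev rmorphM hornerM.
  have evZ x p : ev (x *: p) = mpolyC n x * ev p.
    by rewrite /ev map_polyZ hornerZ.
  have ev1 : ev 1 = 1 by rewrite /ev rmorph1 hornerE.
  have evp (I : finType) (P : pred I) F :
      ev (\prod_(l : I | P l) F l) = \prod_(l | P l) ev (F l).
    by rewrite (big_morph ev evM ev1).
  have Mh : M (s ^+ e * ev h).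
    have -> : s ^+ e * ev h = - \sum_j mpolyC n (c 0 j) *
        (\prod_(l | l != j) (var i - mpolyC n (a l))) *
        (q j * (var i - mpolyC n (a j)) - s ^+ e).
      under eq_bigr do rewrite mulrBr.
      rewrite sumrB opprB (_ : \sum_j _ * (_ * _) = 0) ?subr0.
        rewrite /h /ev rmorph_sum horner_sum mulr_sumr; apply: eq_bigr => j _.
        rewrite -/(ev _) evZ evp mulrC; congr (_ * _ * _).
        by apply: eq_bigr => l _; rewrite evX.
      transitivity ((\sum_j c 0 j *: q j) * \prod_l (var i - mpolyC n (a l))).
        rewrite mulr_suml; apply: eq_bigr => j _.
        by rewrite [in RHS](bigD1 j) //= -mul_mpolyC; ring.
      by rewrite cq mul0r.
    apply: idealN => //; apply: ideal_sum => // j _; apply: MM.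
    by have [_ <-] := De j; apply: qeP.
  have {}Mh : M (ev h) by case: (prime _ _ Mh) => // /avM.
  have [r hE] := closed_field_poly_normal h.
  have lc0 : lead_coef h != 0 by rewrite lead_coef_eq0.
  move: Mh; rewrite hE evZ => /prime [Mc|].
    by apply: M1; rewrite -mpolyC1 -(mulVf lc0) mpolyCM; apply: MM.
  elim: r {hE} => [|x r IH]; first by rewrite big_nil ev1.
  by rewrite big_cons evM => /prime [|/IH //]; rewrite evX => /noa.
have /choice [a aP] := invar.
have Mp := mpoly_sub_meval_ideal idM aP.
have const c : M (mpolyC n c) -> c = 0.
  move=> Mc; apply/eqP/negPn/negP => c0; apply: M1.
  by rewrite -mpolyC1 -(mulVf c0) mpolyCM; apply: MM.
exists a => [p /JM Mpp|].
  apply: const; rewrite -[mpolyC _ _](subKr p); apply: MD => //.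
  exact: idealN.
apply/eqP => s0; apply: (avM 1).
by have := Mp s; rewrite s0 mpolyC0 subr0 expr1.
Qed.
End Nullstellensatz.

(** * A second common zero *)

Section Krull.
Variables (K : closedFieldType) (N : nat).
Hypothesis uncK : ~ countable [set: K].
Local Notation A := (mpoly N.+1 K).
Local Notation var i := (mpolyX K (mnm1 i) : A).
Variable f : 'I_N -> A.
Hypothesis f0 : forall j, meval (fun=> 0) (f j) = 0.

Let J : set A := [set p | exists h : 'I_N -> A, p = \sum_j h j * f j].

Lemma generated_ideal : is_ideal J.
Proof.
split.
- by exists (fun=> 0); rewrite big1 // => j _; rewrite mul0r.
- move=> _ _ [h ->] [k ->]; exists (fun j => h j + k j).
  by rewrite -big_split; apply: eq_bigr => j _; rewrite mulrDl.
- move=> a _ [h ->]; exists (fun j => a * h j).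
  by rewrite mulr_sumr; apply: eq_bigr => j _; rewrite mulrA.
Qed.

Let spanned (s : seq A) (p : A) :=
  exists c : 'I_(size s) -> K, p = \sum_i c i *: s`_i.

Let spanned0 s : spanned s 0.
Proof. by exists (fun=> 0); rewrite big1 // => i _; rewrite scale0r. Qed.

Let spannedD s p q : spanned s p -> spanned s q -> spanned s (p + q).
Proof.
move=> [c ->] [d ->]; exists (fun i => c i + d i).
by rewrite -big_split; apply: eq_bigr => i _; rewrite scalerDl.
Qed.

Let spannedZ s a p : spanned s p -> spanned s (a *: p).
Proof.
move=> [c ->]; exists (fun i => a * c i).
by rewrite scaler_sumr; apply: eq_bigr => i _; rewrite scalerA.
Qed.

Let spanned_sum s (I : finType) (F : I -> A) :
  (forall i, spanned s (F i)) -> spanned s (\sum_i F i).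
Proof. by move=> sF; elim/big_ind: _ => // p q; apply: spannedD. Qed.

Let spanned_mem s p : p \in s -> spanned s p.
Proof.
move=> ps.
exists (fun i => (i == Ordinal (etrans (index_mem p s) ps))%:R).
rewrite (bigD1 (Ordinal (etrans (index_mem p s) ps))) //= eqxx scale1r.
rewrite nth_index // big1 ?addr0 // => j /negPf jn.
by rewrite jn scale0r.
Qed.

Let spanned_mulr s s' q p : (forall x, x \in s -> q * x \in s') ->
  spanned s p -> spanned s' (q * p).
Proof.
move=> ss' [c ->]; rewrite mulr_sumr; apply: spanned_sum => i.
by rewrite -scalerAr; apply/spannedZ/spanned_mem/ss'/mem_nth.
Qed.

(* The elements of the T-th power of the ideal of the origin. *)
Let lowzero T (p : A) := forall m, (mdeg m < T)%N -> mcoeff m p = 0.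

Let lowzeroD T p q : lowzero T p -> lowzero T q -> lowzero T (p + q).
Proof. by move=> p0 q0 m mT; rewrite mcoeffD p0 // q0 // addr0. Qed.

Let lowzero_f j : lowzero 1 (f j).
Proof.
have idM : is_ideal [set p : A | mcoeff (@mnm0 N.+1) p = 0].
  split=> /= [|x y x0 y0|a x x0]; first exact: mcoeff0.
    by rewrite mcoeffD x0 y0 addr0.
  by rewrite rmorphM /= x0 mulr0.
move=> m; rewrite ltnS leqn0 mdeg_eq0 => /eqP ->.
have := @mpoly_sub_meval_ideal K N.+1 _ (fun=> 0) idM _ (f j).
rewrite f0 mpolyC0 subr0; apply=> i.
by rewrite /= subr0 mcoeffX mnm1_eq0.
Qed.

Let lowzeroM T j p : lowzero T p -> lowzero T.+1 (f j * p).
Proof.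
move=> pT m mT; rewrite mcoeffM big1 // => k /eqP mk.
have [k0|k1] := posnP (mdeg k.1); first by rewrite lowzero_f ?mul0r ?k0.
rewrite [X in _ * X]pT ?mulr0 // -ltnS (leq_trans _ mT) // ltnS.
have := congr1 mdeg mk; rewrite mdegD => /esym E.
by apply: leq_trans (eq_leq E); rewrite -add1n leq_add2r.
Qed.

Section Reduction.
Variable e : nat.
Hypothesis eJ : forall i, J (var i ^+ e).

Let boxmon t (a : {ffun 'I_N.+1 -> 'I_t}) : A :=
  \prod_i var i ^+ a i.

(* The monomials with exponents below e times the monomials with exponents below
   T in the f j. *)
Let gens T : seq A :=
  [seq boxmon x.1 * \prod_j f j ^+ x.2 j
     | x : {ffun 'I_N.+1 -> 'I_e} * {ffun 'I_N -> 'I_T}].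

Let size_gens T : size (gens T) = (e ^ N.+1 * T ^ N)%N.
Proof. by rewrite size_map -cardE card_prod !card_ffun !card_ord. Qed.

Let reduce p : exists b h,
  spanned (gens 1) b /\ p = b + \sum_j h j * f j.
Proof.
elim/mpolyind: p => [|c m p _ _ [b [h [sb ->]]]].
  exists 0, (fun=> 0); split=> //; rewrite add0r big1 // => j _.
  by rewrite mul0r.
have [ltm|/existsNP [i /negP]] := pselect (forall i, m i < e)%N; last first.
  rewrite -leqNgt => emi.
  have [g gE] : J (mpolyX K m).
    rewrite mpolyXE_id (bigD1 i) //= -(subnK emi) exprD.
    have [_ _ JM] := generated_ideal.
    by rewrite mulrAC; apply: JM.
  exists b, (fun j => c *: g j + h j); split=> //.
  rewrite gE scaler_sumr addrCA -big_split; congr (_ + _).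
  by apply: eq_bigr => j _; rewrite mulrDl scalerAl.
exists (c *: mpolyX K m + b), h; rewrite addrA; split=> //.
apply: spannedD => //; apply/spannedZ/spanned_mem.
pose a := [ffun i => Ordinal (ltm i)].
apply/mapP; exists (a, [ffun=> ord0]); first by rewrite mem_enum.
rewrite [X in _ * X]big1 ?mulr1 => [|j _]; last by rewrite /= ffunE expr0.
by rewrite mpolyXE_id; apply: eq_bigr => i _; rewrite /= ffunE.
Qed.

Let gens_mulf T j x : x \in gens T -> f j * x \in gens T.+1.
Proof.
move=> /mapP [[a b] _ ->] /=; apply/mapP.
exists (a, [ffun i => inord (b i + (i == j))]); first by rewrite mem_enum.
rewrite mulrCA /=; congr (_ * _).
have E i : nat_of_ord ([ffun i => inord (b i + (i == j))] i : 'I_T.+1) = (b i + (i == j))%N.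
  rewrite ffunE inordK // ltnS (leq_trans (leq_add (leqnn _) (leq_b1 _))) //.
  by rewrite addn1 ltn_ord.
under [in RHS]eq_bigr do rewrite E exprD.
rewrite big_split /= mulrC; congr (_ * _).
rewrite (bigD1 j) //= eqxx expr1 big1 ?mulr1 // => i /negPf ->.
by rewrite expr0.
Qed.

Let gens_sub1 T x : x \in gens 1 -> x \in gens T.+1.
Proof.
move=> /mapP [[a b] _ ->] /=; apply/mapP.
exists (a, [ffun=> ord0]); first by rewrite mem_enum.
rewrite /=; congr (_ * _); rewrite !big1 // => i _.
  by rewrite ffunE expr0.
by rewrite (ord1 (b i)) expr0.
Qed.

(* The reduction b + sum_j h_j f_j of a polynomial is continued with the h_j,
   which are needed one order less. *)
Let truncate T : forall p, exists2 b, spanned (gens T) b & lowzero T (p - b).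
Proof.
elim: T => [|T IH] p; first by exists 0 => // m.
have [b [h [sb ->]]] := reduce p.
have /choice [g gP] j : exists g, spanned (gens T) g /\ lowzero T (h j - g).
  by have [g ? ?] := IH (h j); exists g.
exists (b + \sum_j f j * g j).
  apply: spannedD.
    rewrite -[b]mul1r; apply: spanned_mulr sb => x xg; rewrite mul1r.
    exact: gens_sub1.
  apply: spanned_sum => j; have [sg _] := gP j.
  by apply: spanned_mulr sg => x; apply: gens_mulf.
rewrite opprD addrACA subrr add0r -sumrB.
elim/big_ind: _ => [m _|? ? ? ?|j _]; first by rewrite mcoeff0.
  exact: lowzeroD.
by rewrite mulrC -mulrBr; apply: lowzeroM; have [_] := gP j.
Qed.

(* Modulo the T-th power of the ideal of the origin there are at least
   (T / (N + 1)) ^ (N + 1) independent monomials, but everything is spanned by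
   O(T ^ N) elements. *)
Lemma not_all_powers_in_ideal : False.
Proof.
pose C := (e ^ N.+1 * N.+1 ^ N)%N; pose t := C.+1; pose T := (N.+1 * t)%N.
pose I := {ffun 'I_N.+1 -> 'I_t}.
have /choice [b bP] (a : I) :
    exists b, spanned (gens T) b /\ lowzero T (boxmon a - b).
  by have [b ? ?] := truncate T (boxmon a); exists b.
have /choice [c cP] (a : I) : exists c : 'I_(size (gens T)) -> K,
  b a = \sum_i c i *: (gens T)`_i by have [] := bP a.
pose v (i : 'I_#|{: I}|) := b (enum_val i).
have vE i : v i =
  \sum_j (\matrix_(i1, j) c (enum_val i1) j) i j *: (gens T)`_j.
  by rewrite /v cP; apply: eq_bigr => j _; rewrite mxE.
have [|d d0 dv] := span_dependent _ vE.
  rewrite size_gens card_ffun !card_ord /T expnMn mulnA -/C.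
  by rewrite [(t ^ N.+1)%N]expnS ltn_pmul2r ?expn_gt0.
have low : lowzero T (\sum_i d 0 i *: boxmon (enum_val i)).
  have -> : \sum_i d 0 i *: boxmon (enum_val i) =
      \sum_i d 0 i *: (boxmon (enum_val i) - v i).
    under [RHS]eq_bigr do rewrite scalerBr.
    by rewrite sumrB dv subr0.
  elim/big_ind: _ => [m _|? ? ? ?|j _]; first by rewrite mcoeff0.
    exact: lowzeroD.
  move=> m mT; rewrite mcoeffZ.
  by have [_ ->] := bP (enum_val j); rewrite ?mulr0.
have /rV0Pn [i /eqP] := d0; apply.
pose mon (a : I) := Multinom [tuple (nat_of_ord (a i)) | i < N.+1].
have monE a : boxmon a = mpolyX K (mon a).
  by rewrite mpolyXE_id; apply: eq_bigr => j _; rewrite mnmE.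
have monI a a' : mon a = mon a' -> a = a'.
  move=> /mnmP E; apply/ffunP => j; apply: val_inj.
  by have := E j; rewrite !mnmE.
have deg : (mdeg (mon (enum_val i)) < T)%N.
  rewrite mdegE; apply: leq_ltn_trans (_ : \sum_(j < N.+1) C < T)%N.
    by apply: leq_sum => j _; rewrite mnmE -ltnS ltn_ord.
  by rewrite sum_nat_const card_ord ltn_pmul2l.
have := low _ deg; rewrite raddf_sum (bigD1 i) //= big1 ?addr0 => [|j ji].
  by rewrite mcoeffZ monE mcoeffX eqxx mulr1.
rewrite mcoeffZ monE mcoeffX; case: eqP => [/monI /enum_val_inj E|]; last first.
  by rewrite mulr0.
by rewrite E eqxx in ji.
Qed.

End Reduction.

(** [N] polynomials in [N + 1] variables that vanish at the origin have another
    common zero. Otherwise, by the Nullstellensatz, the ideal that they generate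
    contains a power of every variable, so that modulo [T]-th powers of the
    maximal ideal of the origin all polynomials are combinations of
    [O (T ^ N)] monomials in the [f j], although there are about [T ^ (N + 1)]
    independent monomials in the variables. *)
Theorem second_common_zero :
  exists a : 'I_N.+1 -> K, (forall j, meval a (f j) = 0) /\ exists i, a i != 0.
Proof.
apply: contrapT => /forallNP none.
have pow i : exists e, J (var i ^+ e).
  apply: contrapT => /forallNP av.
  have [a Ja ai] := nullstellensatz uncK generated_ideal av.
  apply: (none a); split; last by exists i; rewrite mevalXU in ai.
  move=> j; apply: Ja; exists (fun k => (k == j)%:R).
  rewrite (bigD1 j) //= eqxx mul1r big1 ?addr0 // => k /negPf ->.
  by rewrite mul0r.
have /choice [e eP] := pow; apply: (@not_all_powers_in_ideal (\max_i e i)) => i.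
rewrite -(subnK (leq_bigmax i)) exprD.
by have [_ _] := generated_ideal; apply.
Qed.

End Krull.

(** * Roots and leading coefficients of polynomials *)

Section PolynomialTools.
Variable K : numClosedFieldType.
Implicit Types p q g : {poly K}.

Lemma mup_deriv p c : p != 0 -> root p c ->
  mup c p = (mup c p^`()).+1.
Proof.
move=> p0 pc; have m0 : (0 < mup c p)%N by rewrite -XsubC_dvd // dvdp_XsubCl.
have /dvdpP [q pE] : ('X - c%:P) ^+ mup c p %| p by rewrite -mup_geq.
have qc : ~~ root q c.
  apply/negP; rewrite -dvdp_XsubCl => /dvdpP [r qE].
  have : ('X - c%:P) ^+ (mup c p).+1 %| p.
    by rewrite [X in _ %| X]pE qE -mulrA -exprS dvdp_mulIr.
  by rewrite -mup_geq // ltnn.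
case E : (mup c p) m0 => [//|m] _; rewrite E in pE; congr _.+1.
have -> : p^`() = (m.+1%:R *: q + ('X - c%:P) * q^`()) * ('X - c%:P) ^+ m.
  rewrite pE derivM deriv_exp derivXsubC mul1r /= exprS -mulr_natl.
  by rewrite -mul_polyC polyCMn; ring.
rewrite mupMr ?mup_XsubCX ?eqxx // /root !hornerE subrr mul0r addr0.
by rewrite mulf_neq0 // pnatr_eq0.
Qed.

Lemma deriv_eq0 p : p^`() = 0 -> p = (p`_0)%:P.
Proof.
move=> p'0; apply/polyP => -[|i]; first by rewrite coefC.
have := congr1 (fun q => q`_i) p'0; rewrite coef_deriv coef0 coefC /=.
by move/eqP; rewrite mulrn_eq0 => /eqP.
Qed.

Lemma size_deriv_char0 p : size p^`() = (size p).-1.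
Proof.
have [->|p0] := eqVneq p 0; first by rewrite deriv0 size_poly0.
apply/eqP; rewrite eqn_leq -ltnS prednK ?size_poly_gt0 // lt_size_deriv //=.
case E : (size p) => [|[|n]] //=; rewrite ltnNge; apply/negP => /leq_sizeP.
move=> /(_ n (leqnn n)) /eqP; rewrite coef_deriv mulrn_eq0 /=.
by rewrite -[n.+1]/(n.+2.-1) -E -lead_coefE lead_coef_eq0 (negPf p0).
Qed.

(** A polynomial has as many distinct roots as its derivative has roots that it
    does not share, plus one; here there are none of the latter. *)
Lemma single_root g : g \is monic -> g != 1 ->
  (forall x, root g^`() x -> root g x) ->
  exists c, g = ('X - c%:P) ^+ (size g).-1.
Proof.
move=> gm g1 gg'; have [rs gE] := closed_field_poly_normal g.
rewrite (monicP gm) scale1r in gE.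
have g0 : g != 0 by rewrite monic_neq0.
have g'0 : g^`() != 0.
  apply: contraNneq g1 => /deriv_eq0 gC; rewrite gC; move: gm.
  by rewrite {1}gC monicE lead_coefC => /eqP ->; rewrite polyC1.
have [rt g'E] := closed_field_poly_normal g^`().
have lc0 : lead_coef g^`() != 0 by rewrite lead_coef_eq0.
have cE x : count_mem x rt = mup x g^`().
  rewrite -mu_prod_XsubC [in RHS]g'E -mul_polyC.
  by rewrite mupMr // rootC.
have rsE x : root g x = (x \in rs) by rewrite gE root_prod_XsubC.
have /perm_size : perm_eq rs (rt ++ undup rs).
  apply/allP => x _ /=; apply/eqP; rewrite count_cat cE.
  rewrite [X in (_ + X)%N]count_uniq_mem ?undup_uniq // mem_undup -rsE.
  rewrite -mu_prod_XsubC -gE.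
  have [gx|gx] := boolP (root g x); first by rewrite mup_deriv ?addn1.
  by rewrite !mupNroot //; apply: contra gx => /gg'.
have srs : size g = (size rs).+1 by rewrite gE size_prod_XsubC.
have srt : size rt = (size rs).-1.
  have := size_deriv_char0 g; rewrite srs {1}g'E size_scale //.
  by rewrite size_prod_XsubC /= => <-.
rewrite size_cat srt srs /= => su.
have rs0 : (0 < size rs)%N.
  rewrite lt0n size_eq0; apply: contraNneq g1 => rs0.
  by rewrite gE rs0 big_nil.
have : size (undup rs) = 1%N.
  by move: su rs0; case: (size rs) => [|z] // /= E _; lia.
case uE : (undup rs) => [|c [|]] // _.
exists c; rewrite gE (eq_big_seq (fun=> 'X - c%:P)) => [|x].
  by rewrite big_const_seq count_predT iter_mulr_1.
by rewrite -mem_undup uE inE => /eqP ->.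
Qed.

Lemma coprime_root_uniq p (rs : seq K) : p = \prod_(x <- rs) ('X - x%:P) ->
  (forall x, root p x -> ~~ root p^`() x) -> uniq rs.
Proof.
move=> pE pp'; rewrite -separable_prod_XsubC -pE unlock.
have p0 : p != 0 by rewrite pE monic_neq0 ?monic_prod_XsubC.
apply/coprimepP => q qp qp'; rewrite -size_poly_eq1; apply/negPn/negP.
move=> /closed_rootP [x qx].
have := pp' x; rewrite -!dvdp_XsubCl in qx *.
by rewrite (dvdp_trans qx qp) (dvdp_trans qx qp') => /(_ isT).
Qed.

(** [p] has degree at most [d], with coefficient [c] in degree [d]. *)
Definition top (d : nat) (c : K) p := (size (p - c *: 'X^d)%R <= d)%N.

Lemma topM d e c b p q : top d c p -> top e b q -> top (d + e) (c * b) (p * q).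
Proof.
rewrite /top => sp sq.
have -> : p * q - (c * b) *: 'X^(d + e) =
    (p - c *: 'X^d) * q + c *: 'X^d * (q - b *: 'X^e).
  by rewrite exprD -!mul_polyC polyCM; ring.
have sq' : (size q <= e.+1)%N.
  rewrite -(subrK (b *: 'X^e) q) (leq_trans (size_polyD _ _)) // geq_max.
  by rewrite (leq_trans sq) // (leq_trans (size_scale_leq _ _)) ?size_polyXn.
have sX : (size (c *: 'X^d : {poly K})%R <= d.+1)%N.
  by rewrite (leq_trans (size_scale_leq _ _)) ?size_polyXn.
rewrite (leq_trans (size_polyD _ _)) // geq_max.
rewrite !(leq_trans (size_polyMleq _ _)) //; lia.
Qed.

Lemma topD d c b p q : top d c p -> top d b q -> top d (c + b) (p + q).
Proof.
rewrite /top => sp sq; rewrite scalerDl opprD addrACA.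
by rewrite (leq_trans (size_polyD _ _)) // geq_max sp.
Qed.

Lemma topZ d a c p : top d c p -> top d (a * c) (a *: p).
Proof.
rewrite /top => sp; rewrite -scalerA -scalerBr.
exact: leq_trans (size_scale_leq _ _) _.
Qed.

Lemma top_natM d a c p : top d c p -> top d (a%:R * c) (a%:R * p).
Proof.
move=> tp; have -> : a%:R * p = a%:R *: p by rewrite mulr_natl scaler_nat.
exact: topZ.
Qed.

Lemma topB d c b p q : top d c p -> top d b q -> top d (c - b) (p - q).
Proof.
move=> tp tq; have := topD tp (topZ (-1) tq).
by rewrite scaleN1r mulN1r.
Qed.

Lemma topXn d : top d 1 'X^d.
Proof. by rewrite /top scale1r subrr size_poly0. Qed.

Lemma top_exp d p m : top d 1 p -> top (m * d) 1 (p ^+ m).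
Proof.
move=> tp; elim: m => [|m IH]; first by rewrite mul0n expr0; apply: (topXn 0).
by rewrite exprS mulSn -[1]mulr1; apply: topM.
Qed.

Lemma top_Xderiv d c p : top d c p -> top d (d%:R * c) ('X * p^`()).
Proof.
rewrite /top => /leq_sizeP sp; apply/leq_sizeP => i di.
have := sp i di; rewrite coefB coefZ coefXn coefB coefZ coefXn coefXM.
case: i di => [|i] di; rewrite ?coef_deriv /=.
  by case: d {sp} di => // _ _; rewrite !mul0r subrr.
case: eqP => [E|_]; rewrite ?mulr0 ?mulr1 ?subr0; last by move=> ->; rewrite mul0rn.
by move=> /eqP; rewrite subr_eq0 => /eqP ->; rewrite mulr_natl E subrr.
Qed.

Lemma top0 d p : top d 0 p -> (size p <= d)%N.
Proof. by rewrite /top scale0r subr0. Qed.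

End PolynomialTools.

(** * Polynomials with two values of high multiplicity *)

(** The unknown coefficients of several polynomials are stored in one sequence
    [x], a block of which, of length [e] from the offset [o] on, gives the
    coefficients below the leading one. *)
Definition monic_of (S : nzRingType) (x : nat -> S) o e : {poly S} :=
  'X^e + \poly_(i < e) x (o + i)%N.

Section MonicOf.

Lemma map_monic_of (S S' : comNzRingType) (phi : {rmorphism S -> S'}) x o e :
  map_poly phi (monic_of x o e) = monic_of (phi \o x) o e.
Proof.
rewrite /monic_of rmorphD /= map_polyXn; congr (_ + _).
apply/polyP => i; rewrite coef_map !coef_poly.
by case: (i < e)%N; rewrite /= ?raddf0.
Qed.

Lemma monic_of0 (S : nzRingType) o e : monic_of (fun=> 0 : S) o e = 'X^e.
Proof.
rewrite /monic_of; apply/polyP => i; rewrite coefD coef_poly.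
by case: ifP; rewrite addr0.
Qed.

Lemma size_monic_of (S : nzRingType) (x : nat -> S) o e :
  size (monic_of x o e) = e.+1.
Proof. by rewrite size_polyDl size_polyXn // ltnS size_poly. Qed.

Lemma monic_of_monic (S : nzRingType) (x : nat -> S) o e :
  monic_of x o e \is monic.
Proof. by rewrite monicE lead_coefDl ?lead_coefXn // size_polyXn ltnS size_poly. Qed.

Lemma monic_of_eqX (S : nzRingType) (x : nat -> S) o e :
  monic_of x o e = 'X^e -> forall i, (i < e)%N -> x (o + i)%N = 0.
Proof.
move=> xE i ie; have := congr1 (fun p : {poly S} => p`_i) xE.
by rewrite coefD coef_poly ie coefXn [i == e]ltn_eqF // add0r.
Qed.

Lemma top_monic_of (K : numClosedFieldType) (x : nat -> K) o e :
  top e 1 (monic_of x o e).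
Proof. by rewrite /top scale1r addrC addKr size_poly. Qed.

Lemma Xderiv_Xn (S : comNzRingType) e :
  'X * ('X^e : {poly S})^`() = e%:R * 'X^e.
Proof.
rewrite derivXn; case: e => [|e]; first by rewrite mulr0n mulr0 mul0r.
by rewrite mulrnAr -exprS mulr_natl.
Qed.

End MonicOf.

(** For [P], [Q], [A], [B] of degrees [k], [r], [m], [k * nu - m] the polynomials
    [P ^ nu.+1 * Q] and [A ^ nu.+1 * 'X^(s.+1) * B] have the degree
    [d = k * nu.+1 + r]. If their difference is constant, their common derivative
    is divisible by [P ^ nu] and by [A ^ nu * 'X^s], and is therefore
    [d * P ^ nu * A ^ nu * 'X^s] for degree reasons. The two equations express
    this; both are multiplied by ['X] and divided by [P ^ nu] in one case and by
    [A ^ nu * 'X^(s.+1)] in the other. *)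
Section Equations.
Variables (nu k r m s : nat) (S : comNzRingType) (x : nat -> S).

Definition polP := monic_of x 0 k.
Definition polQ := monic_of x k r.
Definition polA := monic_of x (k + r) m.
Definition polB := monic_of x (k + r + m) (k * nu - m).

Definition black_eqn : {poly S} :=
  nu.+1%:R * ('X * polP^`()) * polQ + polP * ('X * polQ^`())
  - (k * nu.+1 + r)%:R * (polA ^+ nu * 'X^(s.+1)).

Definition white_eqn : {poly S} :=
  nu.+1%:R * ('X * polA^`()) * polB + s.+1%:R * (polA * polB)
  + polA * ('X * polB^`()) - (k * nu.+1 + r)%:R * polP ^+ nu.

(** The coefficients that do not vanish identically. The constant coefficient of
    the first polynomial does, and its degree drops below [k + r]; the degree of
    the second one drops below [k * nu]. This leaves [d - 1] equations. *)
Definition passport_eqn j : S :=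
  if (j < k + r - 1)%N then black_eqn`_j.+1 else white_eqn`_(j - (k + r - 1)).

End Equations.

Definition exact_root (K : fieldType) n (g : {poly K}) p :=
  exists2 q, g = ('X - p%:P) ^+ n * q & q.[p] != 0.

Lemma exact_root_scale (K : fieldType) n (g : {poly K}) p c : c != 0 ->
  exact_root n g p -> exact_root n (c *: g) p.
Proof.
move=> c0 [q -> qp]; exists (c *: q); first by rewrite scalerAr.
by rewrite hornerZ mulf_neq0.
Qed.

Section TwoValues.
Variables (K : numClosedFieldType) (nu k r m s : nat).
Hypothesis uncK : ~ countable [set: K].
Hypotheses (nu0 : (0 < nu)%N) (k0 : (0 < k)%N).
Hypothesis krE : (k + r = m * nu + s.+1)%N.
Hypothesis mk : (m <= k * nu)%N.
Local Notation d := (k * nu.+1 + r)%N.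
Local Notation beq := (black_eqn nu k r m s).
Local Notation weq := (white_eqn nu k r m s).
Local Notation peq := (passport_eqn nu k r m s).

Lemma number_of_unknowns : d = (k + r + m + (k * nu - m))%N.
Proof. rewrite mulnS; lia. Qed.

Lemma passport_eqn_map (S S' : comNzRingType) (phi : {rmorphism S -> S'}) x j :
  phi (peq x j) = peq (phi \o x) j.
Proof.
have bmap c n P P' Q Q' A : map_poly phi (n%:R * ('X * P') * Q + P * ('X * Q') -
    c%:R * (A ^+ nu * 'X^(s.+1))) = n%:R * ('X * map_poly phi P') * map_poly phi Q
    + map_poly phi P * ('X * map_poly phi Q')
    - c%:R * (map_poly phi A ^+ nu * 'X^(s.+1)).
  by rewrite rmorphB rmorphD !rmorphM !rmorphXn !rmorph_nat /= map_polyX.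
have wmap c n t P A A' B B' : map_poly phi (n%:R * ('X * A') * B + t%:R * (A * B)
    + A * ('X * B') - c%:R * P ^+ nu) = n%:R * ('X * map_poly phi A') * map_poly phi B
    + t%:R * (map_poly phi A * map_poly phi B)
    + map_poly phi A * ('X * map_poly phi B') - c%:R * map_poly phi P ^+ nu.
  by rewrite rmorphB !rmorphD !rmorphM !rmorphXn !rmorph_nat /= map_polyX.
rewrite /passport_eqn; case: ifP => _; rewrite -coef_map; congr (_`_ _).
  rewrite /black_eqn /polP /polQ /polA -!map_monic_of !deriv_map.
  by rewrite (bmap d nu.+1).
rewrite /white_eqn /polP /polA /polB -!map_monic_of !deriv_map.
by rewrite (wmap d nu.+1 s.+1).
Qed.

Lemma passport_eqn0 (S : comNzRingType) j : peq (fun=> 0 : S) j = 0.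
Proof.
have b0 : beq (fun=> 0 : S) = 0.
  rewrite /black_eqn /polP /polQ /polA !monic_of0 !Xderiv_Xn -exprM -exprD -krE.
  by rewrite exprD !natrD natrM; ring.
have w0 : weq (fun=> 0 : S) = 0.
  rewrite /white_eqn /polP /polA /polB !monic_of0 !Xderiv_Xn -exprM.
  rewrite -(subnKC mk) exprD subnKC //.
  have -> : d = (nu.+1 * m + s.+1 + (k * nu - m))%N by rewrite !mulnS; lia.
  by rewrite !natrD natrM; ring.
by rewrite /passport_eqn b0 w0 !coef0 if_same.
Qed.

Lemma black_eqn_size (x : nat -> K) : (size (beq x) <= k + r)%N.
Proof.
have tP := top_monic_of x 0 k; have tQ := top_monic_of x k r.
have tA := top_monic_of x (k + r) m.
have t1 := topM (top_natM nu.+1 (top_Xderiv tP)) tQ.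
have t2 := topM tP (top_Xderiv tQ).
have t3 := top_natM d (topM (top_exp nu tA) (topXn K s.+1)).
rewrite mulnC -krE in t3; have := topB (topD t1 t2) t3.
by rewrite !mulr1 mul1r -natrM -!natrD [(nu.+1 * k)%N]mulnC subrr => /top0.
Qed.

Lemma white_eqn_size (x : nat -> K) : (size (weq x) <= k * nu)%N.
Proof.
have tP := top_exp nu (top_monic_of x 0 k).
have tA := top_monic_of x (k + r) m.
have tB := top_monic_of x (k + r + m) (k * nu - m).
have t1 := topM (top_natM nu.+1 (top_Xderiv tA)) tB.
have t2 := top_natM s.+1 (topM tA tB).
have t3 := topM tA (top_Xderiv tB).
rewrite (subnKC mk) in t1 t2 t3; rewrite mulnC in tP.
have := topB (topD (topD t1 t2) t3) (top_natM d tP).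
rewrite !mulr1 !mul1r -natrM -!natrD.
have -> : (nu.+1 * m + s.+1 + (k * nu - m))%N = d by rewrite !mulnS; lia.
by rewrite subrr => /top0.
Qed.

(** There are [d] unknowns, and zero, where all polynomials are powers of ['X],
    is a solution of the [d - 1] equations. *)
Lemma passport_solution : exists x : nat -> K,
  [/\ beq x = 0, weq x = 0 & exists2 i, (i < d)%N & x i != 0].
Proof.
have d0 : (0 < d)%N by rewrite mulnS; lia.
pose N := d.-1; have NE : N.+1 = d by rewrite prednK.
pose X i : mpoly N.+1 K := mpolyX K (mnm1 (inord i)).
have [|a [fa [i ai]]] := @second_common_zero K N uncK (fun j => peq X j).
  move=> j; rewrite passport_eqn_map -[RHS](@passport_eqn0 K j).
  by congr (peq _ _); apply/funext => i; rewrite /= mevalXU.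
pose x i := a (inord i); exists x.
have px j : (j < N)%N -> peq x j = 0.
  move=> jN; have := fa (Ordinal jN); rewrite passport_eqn_map /= => <-.
  by congr (peq _ _); apply/funext => t; rewrite /= mevalXU.
have sz : N = (k + r - 1 + k * nu)%N by rewrite /N mulnS; lia.
split; last by exists i; rewrite -?NE ?ltn_ord // /x inord_val.
  apply/polyP => -[|j]; rewrite coef0.
    by rewrite coefB coefD !coef0M coefX coefXn /= !(mul0r, mulr0) addr0 subrr.
  have [jk|jk] := ltnP j (k + r - 1); last first.
    by have /leq_sizeP -> // := black_eqn_size x; lia.
  have := px j; rewrite /passport_eqn jk; apply; rewrite sz; lia.
apply/polyP => j; rewrite coef0; have [jk|jk] := ltnP j (k * nu); last first.
  by have /leq_sizeP -> // := white_eqn_size x.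
have := px (k + r - 1 + j)%N;
rewrite /passport_eqn [(_ < k + r - 1)%N]ltnNge leq_addr /= addKn.
by apply; rewrite sz ltn_add2l.
Qed.

Lemma exact_root_pow (P Q : {poly K}) (rs : seq K) p n :
  P = \prod_(x <- rs) ('X - x%:P) -> uniq rs -> p \in rs -> Q.[p] != 0 ->
  exact_root n (P ^+ n * Q) p.
Proof.
move=> PE urs prs Qp.
pose P1 := \prod_(x <- rem p rs) ('X - x%:P).
have PE1 : P = ('X - p%:P) * P1.
  by rewrite PE (perm_big _ (perm_to_rem prs)) big_cons.
exists (P1 ^+ n * Q); first by rewrite PE1 exprMn mulrA.
rewrite hornerM horner_exp mulf_neq0 // expf_neq0 //.
by rewrite -[_ == 0]/(root P1 p) root_prod_XsubC mem_rem_uniq // inE eqxx.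
Qed.

Lemma root_pow (p : {poly K}) e y : (0 < e)%N -> root (p ^+ e) y = root p y.
Proof. by move=> e0; rewrite !rootE horner_exp expf_eq0 e0. Qed.

Lemma pow_X_factor (p q : {poly K}) e : p \is monic -> p * q = 'X^e ->
  p = 'X^((size p).-1).
Proof.
move=> pm pq; have : p %| ('X - 0%:P) ^+ e.
  by rewrite polyC0 subr0 -pq dvdp_mulr.
move=> /dvdp_exp_XsubCP [i _]; rewrite polyC0 subr0.
rewrite eqp_monic ?monicXn // => /eqP ->.
by rewrite size_polyXn.
Qed.

(** There is a polynomial of degree [d] with [k] roots of multiplicity [nu + 1]
    and [m] points of multiplicity [nu + 1] over [1]. It is [P ^ n * Q / v] for
    [n = nu + 1], where [P ^ n * Q - A ^ n * X ^ (s + 1) * B = v] is constant. The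
    coefficients of [P], [Q], [A], [B] come from a nonzero solution of the
    equations. For [v = 0] every root of the derivative would be a root of
    [P ^ n * Q], which would then be a power of [X], as [0] is one of its roots,
    and the solution would be zero. For nonzero [v] the two equations exclude all
    coincidences between roots. *)
Lemma two_value_polynomial_pos : exists (g : {poly K}) (ps zs : seq K),
  [/\ (size g <= d.+1)%N, uniq ps /\ size ps = k, uniq zs /\ size zs = m,
    forall p, p \in ps -> exact_root nu.+1 g p
  & forall z, z \in zs -> exact_root nu.+1 (g - 1) z].
Proof.
have [x [b0 w0 [i0 i0d xi0]]] := passport_solution.
pose P := polP k x; pose Q := polQ k r x.
pose A := polA k r m x; pose B := polB nu k r m x.
have Pm : P \is monic by apply: monic_of_monic.
have Qm : Q \is monic by apply: monic_of_monic.
have Am : A \is monic by apply: monic_of_monic.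
have Bm : B \is monic by apply: monic_of_monic.
have bE : nu.+1%:R * ('X * P^`()) * Q + P * ('X * Q^`()) =
    d%:R * (A ^+ nu * 'X^(s.+1)) by apply/eqP; rewrite -subr_eq0; apply/eqP.
have wE : nu.+1%:R * ('X * A^`()) * B + s.+1%:R * (A * B) + A * ('X * B^`()) =
    d%:R * P ^+ nu by apply/eqP; rewrite -subr_eq0; apply/eqP.
pose G := P ^+ nu.+1 * Q; pose H := A ^+ nu.+1 * ('X^(s.+1) * B).
have XG' : 'X * G^`() = d%:R * (P ^+ nu * A ^+ nu * 'X^(s.+1)).
  rewrite /G derivM deriv_exp /= -mulr_natl.
  transitivity (P ^+ nu * (nu.+1%:R * ('X * P^`()) * Q + P * ('X * Q^`()))).
    by rewrite exprS; ring.
  by rewrite bE; ring.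
have XH' : 'X * H^`() = d%:R * (P ^+ nu * A ^+ nu * 'X^(s.+1)).
  have X' : ('X^(s.+1))^`() = s.+1%:R * 'X^s :> {poly K}.
    by rewrite derivXn mulr_natl.
  rewrite /H derivM deriv_exp derivM X' /= -[_ *+ nu.+1]mulr_natl.
  transitivity (A ^+ nu * 'X^(s.+1) * (nu.+1%:R * ('X * A^`()) * B +
      s.+1%:R * (A * B) + A * ('X * B^`()))).
    rewrite (exprS A) (exprS 'X).
    have ringE (a y A1 B1 n t A0 B0 X : {poly K}) :
        X * (n * (A1 * a) * (X * y * B0) + A0 * a * (t * y * B0 + X * y * B1)) =
        a * (X * y) * (n * (X * A1) * B0 + t * (A0 * B0) + A0 * (X * B1)) by ring.
    exact: ringE.
  by rewrite wE; ring.
have X0 : 'X != 0 :> {poly K} by rewrite polyX_eq0.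
have dnz : d%:R != 0 :> K by rewrite pnatr_eq0 mulnS; lia.
have rootd (q : {poly K}) y : root (d%:R * q) y = root q y.
  by rewrite -polyC_natr rootM rootC (negPf dnz).
have /deriv_eq0 vE : (G - H)^`() = 0.
  by apply: (mulfI X0); rewrite derivB mulrBr XG' XH' subrr mulr0.
set v := _`_0 in vE.
have GH : G = H + v%:P by rewrite -vE addrC subrK.
have sG : size G = d.+1.
  rewrite size_monicM ?monic_neq0 ?monic_exp // [size Q]size_monic_of.
  have Pn0 : P ^+ nu.+1 != 0 by rewrite monic_neq0 ?monic_exp.
  by rewrite (polySpred Pn0) size_exp [size P]size_monic_of addSn addnS.
have Gm : G \is monic by rewrite monicMl ?monic_exp.
have v0 : v != 0.
  apply/eqP => v0; rewrite v0 addr0 in GH.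
  have [c Gc] : exists c, G = ('X - c%:P) ^+ (size G).-1.
    apply: single_root => //.
      apply/eqP => G1; move: sG; rewrite G1 size_poly1 mulnS; lia.
    move=> y Gy.
    have Hy : root ('X * G^`()) y by rewrite rootM Gy orbT.
    rewrite XG' rootd !rootM !root_pow // in Hy.
    case/orP: Hy => [/orP[Py|Ay]|y0]; last 2 first.
    - by rewrite GH /H !rootM root_pow // Ay.
    - by rewrite GH /H !rootM (@root_pow 'X) // y0 /= orbT.
    by rewrite /G !rootM root_pow // Py.
  have c0 : c = 0.
    have : root G 0 by rewrite GH /H !rootM (@root_pow 'X) //= rootX eqxx orbT.
    rewrite Gc root_pow ?root_XsubC; first by move=> /eqP.
    by rewrite sG mulnS; lia.
  rewrite c0 subr0 in Gc.
  have zero o e q i : monic_of x o e * q = G -> (o <= i < o + e)%N -> x i = 0.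
    rewrite Gc => /pow_X_factor; rewrite size_monic_of => /(_ (monic_of_monic _ _ _)).
    move=> /monic_of_eqX xe /andP[oi ie].
    by rewrite -(subnKC oi); apply: xe; rewrite ltn_subLR.
  move/eqP: xi0; apply; rewrite number_of_unknowns in i0d.
  have [ik|ki] := ltnP i0 k.
    by apply: (zero 0 k (P ^+ nu * Q)); rewrite // -[monic_of _ _ _]/P mulrA -(exprS P).
  have [ir|ri] := ltnP i0 (k + r)%N.
    by apply: (zero k r (P ^+ nu.+1)); rewrite ?ki // -[monic_of _ _ _]/Q mulrC.
  have [im|mi] := ltnP i0 (k + r + m)%N.
    apply: (zero (k + r)%N m (A ^+ nu * ('X^(s.+1) * B))); last by rewrite ri.
    by rewrite -[monic_of _ _ _]/A (mulrA A) -(exprS A) GH.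
  apply: (zero (k + r + m)%N (k * nu - m)%N (A ^+ nu.+1 * 'X^(s.+1))).
    by rewrite -[monic_of _ _ _]/B mulrC -mulrA GH.
  by rewrite mi.
have sP : size P = k.+1 by apply: size_monic_of.
have sA : size A = m.+1 by apply: size_monic_of.
clearbody P Q A B.
have noroot y : ~~ (root G y && root H y).
  apply/negP => /andP[Gy Hy]; case/negP: v0; move: Gy.
  by rewrite GH rootE hornerD (eqP Hy) add0r hornerC.
have P_A y : root P y -> ~~ root (A ^+ nu * 'X^(s.+1)) y.
  move=> Py; apply/negP; rewrite rootM !root_pow // => Ay.
  case/negP: (noroot y); rewrite /G /H !rootM !root_pow // Py /=.
  by case/orP: Ay => ->; rewrite ?orbT.
have A_P y : root (A * ('X^(s.+1) * B)) y -> ~~ root P y.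
  rewrite !rootM root_pow // => Ay; apply/negP => Py.
  by case/negP: (noroot y); rewrite /G /H !rootM !root_pow // Py.
have P'P y : root P y -> root P^`() y = false.
  move=> Py; apply/negP => P'y; case/negP: (P_A y Py).
  have := congr1 (root^~ y) bE; rewrite rootd => <-.
  by rewrite rootE hornerD !hornerM (eqP Py) (eqP P'y) !(mulr0, mul0r) addr0.
have QP y : root P y -> root Q y = false.
  move=> Py; apply/negP => Qy; case/negP: (P_A y Py).
  have := congr1 (root^~ y) bE; rewrite rootd => <-.
  by rewrite rootE hornerD !hornerM (eqP Py) (eqP Qy) !(mulr0, mul0r) addr0.
have wP y : root A y -> root ('X * A^`() * B) y -> root P y.
  move=> Ay XB; have := congr1 (root^~ y) wE.
  rewrite rootd root_pow // => <-.
  rewrite -mulrA rootE hornerD hornerD !hornerM (eqP Ay) ?(mulr0, mul0r) ?addr0.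
  by move: XB; rewrite rootE !hornerM => /eqP ->; rewrite mulr0.
have A_P' y : root A y -> ~~ root P y by move=> Ay; apply: A_P; rewrite rootM Ay.
have A'A y : root A y -> root A^`() y = false.
  move=> Ay; apply/negP => A'y; case/negP: (A_P' y Ay); apply: wP => //.
  by rewrite !rootM A'y orbT.
have BA y : root A y -> ('X^(s.+1) * B).[y] != 0.
  move=> Ay; apply/negP; rewrite -rootE => By; case/negP: (A_P' y Ay).
  by apply: wP => //; move: By; rewrite !rootM root_pow // => /orP[->|->]; rewrite ?orbT.
have [ps PE] := closed_field_poly_normal P; rewrite (monicP Pm) scale1r in PE.
have [zs AE] := closed_field_poly_normal A; rewrite (monicP Am) scale1r in AE.
have ups : uniq ps by apply: (coprime_root_uniq PE) => y Py; rewrite P'P.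
have uzs : uniq zs by apply: (coprime_root_uniq AE) => y Ay; rewrite A'A.
exists (v^-1 *: G), ps, zs; split.
- by rewrite size_scale ?invr_eq0 // sG.
- split=> //; by move: sP; rewrite PE size_prod_XsubC => -[].
- split=> //; by move: sA; rewrite AE size_prod_XsubC => -[].
- move=> p pps; apply: exact_root_scale; rewrite ?invr_eq0 //.
  apply: (exact_root_pow _ PE ups pps).
  by rewrite -[_ == 0]/(root Q p) QP // PE root_prod_XsubC.
move=> z zzs; have -> : v^-1 *: G - 1 = v^-1 *: H.
  by rewrite GH scalerDr -alg_polyC scalerA mulVf // scale1r addrK.
apply: exact_root_scale; rewrite ?invr_eq0 //.
apply: (exact_root_pow _ AE uzs zzs).
by apply: BA; rewrite AE root_prod_XsubC.
Qed.

End TwoValues.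

(** A point of multiplicity [nu + 1] is a zero of multiplicity [nu] of the
    derivative, so that there are at most [(d - 1) %/ nu] of them over all values
    together: the polynomial attains this bound, with as many points as possible
    over one value. *)
Theorem two_value_polynomial (K : numClosedFieldType) (nu d : nat) :
  ~ countable [set: K] -> (0 < nu)%N -> (0 < d)%N ->
  exists (g : {poly K}) (ps zs : seq K),
  [/\ (size g <= d.+1)%N, uniq ps /\ size ps = (d %/ nu.+1)%N,
    uniq zs /\ (size zs + d %/ nu.+1 = (d - 1) %/ nu)%N,
    forall p, p \in ps -> exact_root nu.+1 g p
  & forall z, z \in zs -> exact_root nu.+1 (g - 1) z].
Proof.
move=> uncK nu0 d0; set k := (d %/ nu.+1)%N; pose r := (d %% nu.+1)%N.
have dE : d = (k * nu.+1 + r)%N := divn_eq d nu.+1.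
have rn : (r < nu.+1)%N by rewrite ltn_pmod.
have [k0|k0] := posnP k.
  have N0 : ((d - 1) %/ nu = 0)%N.
    by rewrite divn_small //; move: dE rn d0; rewrite k0 mul0n; lia.
  exists 0, [::], [::]; split=> //; first by rewrite size_poly0.
  by rewrite N0 k0.
pose m := ((k + r - 1) %/ nu)%N; pose s := ((k + r - 1) %% nu)%N.
have krE : (k + r = m * nu + s.+1)%N.
  by rewrite addnS -divn_eq subn1 prednK // ltn_addr.
have mk : (m <= k * nu)%N.
  apply: leq_trans (leq_pmulr k nu0); rewrite -ltnS ltn_divLR // mulSn.
  have := leq_pmulr k nu0; lia.
have [g [ps [zs [sg [ups sps] [uzs szs] gps gzs]]]] :=
  two_value_polynomial_pos uncK nu0 k0 krE mk.
exists g, ps, zs; split=> //; first by rewrite dE.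
split=> //; have -> : (d - 1 = k * nu + (k + r - 1))%N by rewrite {1}dE mulnS; lia.
by rewrite szs divnMDl // addnC.
Qed.

(** * Norms on complex row vectors and Banach's theorem *)

Section RealNorms.
Variable R : realType.
Local Notation C := (Cplx R).

(** The norms of [C] and of ['M[C]_(m, n)] have values in [C]; for inequalities
    these values are taken in the ordered field [R]. *)
Definition cnorm (z : C) : R := complex.Re (`|z| : R[i]).
Definition mnorm m n (x : 'M[C]_(m, n)) : R := complex.Re (`|x| : R[i]).

Lemma cnormE (z : C) : `|z| = (cnorm z)%:C%C.
Proof. by rewrite /cnorm RRe_real // normr_real. Qed.

Lemma mnormE m n (x : 'M[C]_(m, n)) : `|x| = (mnorm x)%:C%C.
Proof. by rewrite /mnorm RRe_real // realE. Qed.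

Lemma realC_le (a b : R) : (a%:C%C <= b%:C%C :> C) = (a <= b).
Proof. exact: lecR. Qed.

Lemma realC_lt (a b : R) : (a%:C%C < b%:C%C :> C) = (a < b).
Proof. exact: ltcR. Qed.

Lemma realCD (a b : R) : a%:C%C + b%:C%C = (a + b)%:C%C :> C.
Proof. by rewrite -rmorphD. Qed.

Lemma realCM (a b : R) : a%:C%C * b%:C%C = (a * b)%:C%C :> C.
Proof. by rewrite -rmorphM. Qed.

Lemma cnorm_ge0 z : 0 <= cnorm z.
Proof. by rewrite -realC_le -cnormE; apply: (@normr_ge0 _ C). Qed.

Lemma cnormD z w : cnorm (z + w) <= cnorm z + cnorm w.
Proof. by rewrite -realC_le -realCD -!cnormE; apply: ler_normD. Qed.

Lemma cnormM z w : cnorm (z * w) = cnorm z * cnorm w.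
Proof.
by apply: (@complexI R); rewrite -[RHS]realCM -!cnormE; apply: normrM.
Qed.

Lemma cnorm0 : cnorm 0 = 0.
Proof. by rewrite /cnorm normr0. Qed.

Lemma mnorm_ge0 m n (x : 'M[C]_(m, n)) : 0 <= mnorm x.
Proof. by rewrite -realC_le -mnormE; apply: (@normr_ge0 C). Qed.

Lemma mnorm0 m n : mnorm (0 : 'M[C]_(m, n)) = 0.
Proof. by rewrite /mnorm normr0. Qed.

Lemma mnorm0_eq0 m n (x : 'M[C]_(m, n)) : mnorm x = 0 -> x = 0.
Proof. by move=> x0; apply: (@normr0_eq0 C); rewrite mnormE x0. Qed.

Lemma mnormD m n (x y : 'M[C]_(m, n)) : mnorm (x + y) <= mnorm x + mnorm y.
Proof. by rewrite -realC_le -realCD -!mnormE; apply: (@ler_normD C). Qed.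

Lemma mnormN m n (x : 'M[C]_(m, n)) : mnorm (- x) = mnorm x.
Proof. by rewrite /mnorm normrN. Qed.

Lemma mnormBC m n (x y : 'M[C]_(m, n)) : mnorm (x - y) = mnorm (y - x).
Proof. by rewrite -mnormN opprB. Qed.

Lemma mnormZ m n z (x : 'M[C]_(m, n)) : mnorm (z *: x) = cnorm z * mnorm x.
Proof.
by apply: (@complexI R); rewrite -[RHS]realCM -cnormE -!mnormE; apply: normrZ.
Qed.

Lemma cnorm_entry m n (x : 'M[C]_(m, n)) i j : cnorm (x i j) <= mnorm x.
Proof.
rewrite -realC_le -cnormE -mnormE [leRHS]/Num.norm /= mx_normE.
by rewrite -[leLHS]nngE num_le; apply: (le_bigmax _ _ (i, j)).
Qed.

Lemma mnorm_le m n (x : 'M[C]_(m, n)) b : 0 <= b ->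
  (forall i j, cnorm (x i j) <= b) -> mnorm x <= b.
Proof.
move=> b0 xb; rewrite -realC_le -mnormE [leLHS]/Num.norm /= mx_normE.
have b0' : 0 <= b%:C%C :> C by rewrite realC_le.
rewrite -[leRHS]/((NngNum b0')%:num) num_le; apply/bigmax_leP.
split=> [|[i j] _]; first by rewrite -num_le.
by rewrite -num_le /= cnormE realC_le.
Qed.

Lemma mnorm_mulmx n p (v : 'rV[C]_n) (M : 'M[C]_(n, p)) :
  mnorm (v *m M) <= n%:R * mnorm M * mnorm v.
Proof.
have M0 := mnorm_ge0 M; have v0 := mnorm_ge0 v.
apply: mnorm_le => [|i j]; first by rewrite !mulr_ge0.
rewrite mxE -mulrA mulr_natl -[X in _ *+ X]card_ord -sumr_const.
elim/big_ind2: _ => [|x a y b xa yb|k _]; first by rewrite cnorm0.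
  exact: le_trans (cnormD _ _) (lerD _ _).
by rewrite cnormM mulrC ler_pM ?cnorm_ge0 ?cnorm_entry.
Qed.

Lemma nbhs_mnormP m n (a : 'M[C]_(m, n)) (P : set 'M[C]_(m, n)) :
  (\forall x \near a, P x) <->
  exists2 e : R, 0 < e & forall x, mnorm (x - a) < e -> P x.
Proof.
split=> [/nbhs_normP [e /= e0 eP]|[e e0 eP]].
  have eE : e = (complex.Re e)%:C%C by rewrite RRe_real // realE ltW.
  exists (complex.Re e); first by rewrite -realC_lt -eE.
  by move=> x xa; apply: eP; rewrite /ball_ /= mnormE mnormBC eE realC_lt.
apply/nbhs_normP; exists e%:C%C => [|x]; first by rewrite /= realC_lt.
by rewrite /ball_ /= mnormE mnormBC realC_lt => /eP.
Qed.

End RealNorms.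

Ltac norm_lra := clear; lra.

Section FixedPoint.
Variable R : realType.
Local Notation C := (Cplx R).

(** The intervals of radius [2 c / 2 ^ k] around the [u k] are nested. *)
Lemma real_geometric_limit (u : nat -> R) c :
  (forall k, `|u k.+1 - u k| <= c * 2^-1 ^+ k) ->
  exists l, forall k, `|u k - l| <= 2 * c * 2^-1 ^+ k.
Proof.
move=> uc; pose lo k := u k - 2 * c * 2^-1 ^+ k.
pose hi k := u k + 2 * c * 2^-1 ^+ k.
have step k : lo k <= lo k.+1 /\ hi k.+1 <= hi k.
  have := uc k; rewrite /lo /hi ler_norml exprS => /andP[]; lra.
have lohi k : lo k <= hi k.
  by have := le_trans (normr_ge0 _) (uc k); rewrite /lo /hi; lra.
have loD i j : lo i <= lo (i + j)%N.
  by elim: j => [|j IH]; rewrite ?addn0 // addnS (le_trans IH) //; case: (step (i + j)%N).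
have hiD i j : hi (i + j)%N <= hi i.
  by elim: j => [|j IH]; rewrite ?addn0 // addnS (le_trans _ IH) //; case: (step (i + j)%N).
have lo_hi i j : lo i <= hi j.
  by rewrite (le_trans (loD i j)) // (le_trans (lohi _)) // addnC hiD.
exists (sup (range lo)) => k.
have l1 : lo k <= sup (range lo).
  apply: ub_le_sup; last by exists k.
  by exists (hi 0%N) => _ [i _ <-]; apply: lo_hi.
have l2 : sup (range lo) <= hi k.
  apply: ge_sup; first by exists (lo 0%N); exists 0%N.
  by move=> _ [i _ <-]; apply: lo_hi.
by rewrite ler_norml; move: l1 l2; rewrite /lo /hi; lra.
Qed.

Lemma real_le_geometric (a b c : R) :
  (forall k, a <= b + c * 2^-1 ^+ k) -> a <= b.
Proof.
move=> abc; apply/ler_addgt0Pr => e e0.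
have /cvgrPdist_lt : (fun k => c * (2^-1 : R) ^+ k) @ \oo --> (0 : R).
  rewrite -[X in _ --> X](mulr0 c); apply: cvgMl_tmp.
  by apply: cvg_expr; rewrite ger0_norm ?invr_ge0 // invf_lt1 ?ltr1n.
move=> /(_ e e0) [k _ /(_ k (leqnn k))] /=.
rewrite sub0r normrN => /ltr_normlW; have := abc k; lra.
Qed.

Lemma cnorm_Re (z : C) : `|complex.Re z| <= cnorm z.
Proof. by rewrite -realC_le -cnormE; apply: normc_ge_Re. Qed.

Lemma cnorm_ReIm (z : C) : cnorm z <= `|complex.Re z| + `|complex.Im z|.
Proof.
rewrite /cnorm normc_def /=; set x := complex.Re z; set y := complex.Im z.
rewrite -[leRHS]ger0_norm ?addr_ge0 // -sqrtr_sqr ler_wsqrtr //.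
rewrite sqrrD !real_normK ?num_real // addrAC lerDl.
by rewrite mulrn_wge0 // mulr_ge0.
Qed.

Lemma cnorm_Im (z : C) : `|complex.Im z| <= cnorm z.
Proof.
rewrite /cnorm normc_def /= -sqrtr_sqr ler_wsqrtr //.
by rewrite lerDr sqr_ge0.
Qed.

Lemma geometric_limit n (u : nat -> 'rV[C]_n) c : 0 <= c ->
  (forall k, mnorm (u k.+1 - u k) <= c * 2^-1 ^+ k) ->
  exists l, forall k, mnorm (u k - l) <= 4 * c * 2^-1 ^+ k.
Proof.
move=> c0 uc.
have uc' k j : cnorm (u k.+1 0 j - u k 0 j) <= c * 2^-1 ^+ k.
  apply: le_trans (uc k); have := cnorm_entry (u k.+1 - u k) 0 j.
  by rewrite !mxE.
have /choice [x xP] j : exists x, forall k,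
    `|complex.Re (u k 0 j) - x| <= 2 * c * 2^-1 ^+ k.
  apply: real_geometric_limit => k; apply: le_trans (uc' k j).
  by rewrite -raddfB; apply: cnorm_Re.
have /choice [y yP] j : exists y, forall k,
    `|complex.Im (u k 0 j) - y| <= 2 * c * 2^-1 ^+ k.
  apply: real_geometric_limit => k; apply: le_trans (uc' k j).
  by rewrite -raddfB; apply: cnorm_Im.
exists (\row_j ((x j) +i* (y j))%C) => k; apply: mnorm_le => [|i j].
  by rewrite !mulr_ge0 ?exprn_ge0 ?invr_ge0.
rewrite !mxE ord1; apply: le_trans (cnorm_ReIm _) _.
have := xP j k; have := yP j k.
set z := u k 0 j; case: z => a b /=; lra.
Qed.

(** Banach's fixed point theorem on a closed ball of [C ^ n]. *)
Lemma ball_fixed_point n (T : 'rV[C]_n -> 'rV[C]_n) a (r : R) : 0 <= r ->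
  (forall x y, mnorm (x - a) <= r -> mnorm (y - a) <= r ->
     mnorm (T x - T y) <= 2^-1 * mnorm (x - y)) ->
  mnorm (T a - a) <= 2^-1 * r ->
  exists2 x, mnorm (x - a) <= r & T x = x.
Proof.
move=> r0 Tc Ta; pose u k := iter k T a.
have aa : mnorm (a - a) <= r by rewrite subrr mnorm0.
have ub k : mnorm (u k - a) <= r.
  elim: k => [//|k IH]; rewrite /= -(subrKA (T a)).
  have := mnormD (T (u k) - T a) (T a - a); have := Tc _ _ IH aa.
  by move: Ta IH; rewrite /u; norm_lra.
have du k : mnorm (u k.+1 - u k) <= (2^-1 * r) * 2^-1 ^+ k.
  elim: k => [|k IH]; first by rewrite expr0 mulr1.
  by have := Tc _ _ (ub k.+1) (ub k); rewrite exprS; move: IH; rewrite /u /=; norm_lra.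
have [|l lP] := geometric_limit _ du; first by rewrite mulr_ge0 ?invr_ge0.
have la : mnorm (l - a) <= r.
  apply: (@real_le_geometric _ _ (2 * r)) => k.
  rewrite -(subrKA (u k)); have := mnormD (l - u k) (u k - a).
  by have := lP k; have := ub k; rewrite (mnormBC l) /u; norm_lra.
exists l => //; apply/eqP; rewrite -subr_eq0; apply/eqP/mnorm0_eq0.
apply: le_anti; rewrite mnorm_ge0 andbT.
apply: (@real_le_geometric _ _ (2 * r)) => k; rewrite add0r.
rewrite -(subrKA (u k.+1)); have := mnormD (T l - u k.+1) (u k.+1 - l).
have := Tc _ _ la (ub k); have := lP k; have := lP k.+1.
by rewrite (mnormBC l) exprS /u /=; norm_lra.
Qed.

End FixedPoint.

(** * The inverse function theorem *)

Lemma differentiable_expansion (K : numFieldType) (V W : normedModType K)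
    (f : V -> W) (df : {linear V -> W}) (a : V) : continuous df ->
  (forall e, 0 < e -> \forall h \near (0 : V),
     `|f (h + a) - f a - df h| <= e * `|h|) ->
  differentiable f a.
Proof.
move=> dfc fdf; have exp : f \o shift a = cst (f a) + df +o_ 0 id.
  by apply/eqaddoP => e e0; apply: filterS (fdf e e0) => h; rewrite opprD addrA.
by apply/diff_locallyP; rewrite (diff_unique dfc exp).
Qed.

Section InverseFunction.
Variable R : realType.
Local Notation C := (Cplx R).

(** The difference quotients of [f] at two points that both tend to [a] are
    close to the linear map [L]; unlike differentiability at [a] alone, this
    gives a local inverse when [L] is invertible. *)
Definition strict_diff n p (f : 'rV[C]_n -> 'rV[C]_p) (a : 'rV[C]_n) (L : 'M[C]_(n, p)) :=
  forall e : R, 0 < e -> exists2 d : R, 0 < d & forall x y,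
    mnorm (x - a) < d -> mnorm (y - a) < d ->
    mnorm (f x - f y - (x - y) *m L) <= e * mnorm (x - y).

Definition strictly_diff_near n p (f : 'rV[C]_n -> 'rV[C]_p) (a : 'rV[C]_n) :=
  \forall x \near a, exists L, strict_diff f x L.

(* A positive Lipschitz constant of the map given by the matrix. *)
Definition mxlip n p (L : 'M[C]_(n, p)) : R := n%:R * mnorm L + 1.

Lemma mxlip_gt0 n p (L : 'M[C]_(n, p)) : 0 < mxlip L.
Proof. by rewrite ltr_wpDl // mulr_ge0 ?mnorm_ge0. Qed.

Lemma mnorm_mulmx_lip n p (v : 'rV[C]_n) (L : 'M[C]_(n, p)) :
  mnorm (v *m L) <= mxlip L * mnorm v.
Proof.
apply: le_trans (mnorm_mulmx _ _) _.
by rewrite ler_wpM2r ?mnorm_ge0 // lerDl.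
Qed.

Lemma strict_diff_lip n p (f : 'rV[C]_n -> 'rV[C]_p) (a : 'rV[C]_n) L : strict_diff f a L ->
  exists K d : R, [/\ 0 < K, 0 < d & forall x y,
    mnorm (x - a) < d -> mnorm (y - a) < d ->
    mnorm (f x - f y) <= K * mnorm (x - y)].
Proof.
move=> /(_ 1 ltr01) [d d0 fd]; exists (1 + mxlip L), d.
split=> // [|x y xa ya]; first by rewrite ltr_wpDl // mxlip_gt0.
rewrite -(subrK ((x - y) *m L) (f x - f y)).
have := mnormD (f x - f y - (x - y) *m L) ((x - y) *m L).
have := fd _ _ xa ya; have := mnorm_mulmx_lip (x - y) L; norm_lra.
Qed.

(** The continuity of [f] at [a]. *)
Lemma strict_diff_near n p (f : 'rV[C]_n -> 'rV[C]_p) (a : 'rV[C]_n) L P :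
  strict_diff f a L -> (\forall y \near f a, P y) -> \forall x \near a, P (f x).
Proof.
move=> /strict_diff_lip [K [d [K0 d0 fK]]] /nbhs_mnormP [e e0 eP].
apply/nbhs_mnormP; exists (Num.min d (e / K)) => [|x].
  by rewrite lt_min d0 divr_gt0.
rewrite lt_min ltr_pdivlMr // mulrC => /andP[xd xe]; apply: eP.
by apply: le_lt_trans xe; apply: fK; rewrite // subrr mnorm0.
Qed.

Lemma strict_diff_comp n p q (f : 'rV[C]_n -> 'rV[C]_p)
    (g : 'rV[C]_p -> 'rV[C]_q) (a : 'rV[C]_n) L M :
  strict_diff f a L -> strict_diff g (f a) M -> strict_diff (g \o f) a (L *m M).
Proof.
move=> fL gM e e0; have [K [d1 [K0 d10 fK]]] := strict_diff_lip fL.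
have M0 := mxlip_gt0 M.
have [|d2 d20 fd2] := fL (e / (2 * mxlip M)).
  by rewrite divr_gt0 ?mulr_gt0.
have [|d3 d30 gd3] := gM (e / (2 * K)); first by rewrite divr_gt0 ?mulr_gt0.
exists (Num.min d1 (Num.min d2 (d3 / K))) => [|x y].
  by rewrite !lt_min d10 d20 divr_gt0.
rewrite !lt_min !ltr_pdivlMr // ![_ * K]mulrC.
move=> /and3P[x1 x2 x3] /and3P[y1 y2 y3].
have aa : mnorm (a - a) < d1 by rewrite subrr mnorm0.
have := gd3 _ _ (le_lt_trans (fK _ _ x1 aa) x3) (le_lt_trans (fK _ _ y1 aa) y3).
set u := g _ - g _ - _ => gu; have fu := fd2 _ _ x2 y2.
have -> : (g \o f) x - (g \o f) y - (x - y) *m (L *m M) =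
    u + (f x - f y - (x - y) *m L) *m M.
  by rewrite [X in u + X]mulmxBl -mulmxA /u [in RHS]addrA subrK.
have := mnormD u ((f x - f y - (x - y) *m L) *m M).
have := mnorm_mulmx_lip (f x - f y - (x - y) *m L) M; set w := mnorm (_ *m M).
move: fu gu (fK _ _ x1 y1); set t := mnorm (f x - f y - _).
set z := mnorm (x - y) => tz uz fz wt uw.
have h1 : w <= e / 2 * z.
  apply: le_trans wt _; apply: le_trans (ler_wpM2l (ltW M0) tz) _.
  by rewrite mulrA le_eqVlt; apply/orP; left; apply/eqP; field; rewrite gt_eqF.
have h2 : mnorm u <= e / 2 * z.
  apply: le_trans uz _; apply: le_trans (ler_wpM2l _ fz) _.
    by rewrite divr_ge0 ?mulr_ge0 // ltW.
  by rewrite mulrA le_eqVlt; apply/orP; left; apply/eqP; field; rewrite gt_eqF.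
by move: h1 h2 uw; norm_lra.
Qed.

Lemma strictly_diff_near_comp n p q (f : 'rV[C]_n -> 'rV[C]_p)
    (g : 'rV[C]_p -> 'rV[C]_q) (a : 'rV[C]_n) :
  strictly_diff_near f a -> strictly_diff_near g (f a) ->
  strictly_diff_near (g \o f) a.
Proof.
move=> fn gn; have [L fL] := nbhs_singleton fn.
have := strict_diff_near fL gn; move: fn; apply: filterS2 => x [L' fL'] [M gM].
by exists (L' *m M); apply: strict_diff_comp.
Qed.

Lemma strict_diff_differentiable n p (f : 'rV[C]_n -> 'rV[C]_p) (a : 'rV[C]_n) L :
  strict_diff f a L -> differentiable f a.
Proof.
move=> fL; pose df : {linear 'rV[C]_n -> 'rV[C]_p} := mulmxr L.
have dfL x : strict_diff df x L.
  move=> e e0; exists 1 => // y z _ _; rewrite /= mulmxBl subrr mnorm0.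
  by rewrite mulr_ge0 ?mnorm_ge0 // ltW.
have dfc : continuous df by move=> x P; apply: strict_diff_near (dfL x).
apply: (differentiable_expansion dfc) => e e0.
have eE : e = (complex.Re e)%:C%C by rewrite RRe_real // realE ltW.
have [|d d0 fd] := fL (complex.Re e); first by rewrite -realC_lt -eE.
apply/nbhs_mnormP; exists d => // x; rewrite subr0 => xd.
rewrite !mnormE eE realCM realC_le.
have := fd (x + a) a; rewrite addrK subrr mnorm0; exact.
Qed.

Lemma half_absorb (a b c d : R) :
  a <= b + c -> b <= d -> c <= 2^-1 * a -> a <= 2 * d.
Proof. lra. Qed.

(** The map [x |-> x - (f x - y) *m L^-1] is a contraction of a small ball around
    [a] for every [y] close to [f a]; its fixed point is the preimage of [y]. *)
Theorem local_inverse n (f : 'rV[C]_n -> 'rV[C]_n) (a : 'rV[C]_n) L :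
  strict_diff f a L -> L \in unitmx -> strictly_diff_near f a ->
  exists g : 'rV[C]_n -> 'rV[C]_n,
  [/\ g (f a) = a, \forall x \near a, g (f x) = x,
      \forall y \near f a, f (g y) = y & strictly_diff_near g (f a)].
Proof.
move=> fL Lu fn; pose J := invmx L; pose k := mxlip J.
have k0 : 0 < k := mxlip_gt0 J.
have Jk v : mnorm (v *m J) <= k * mnorm v := mnorm_mulmx_lip v J.
have [|d d0 fd] := fL (2 * k)^-1; first by rewrite invr_gt0 mulr_gt0.
have /nbhs_mnormP [d' d'0 fd'] := fn.
pose r := Num.min d d' / 2.
have r0 : 0 < r by rewrite divr_gt0 // lt_min d0.
have [rd rd'] : r < d /\ r < d'.
  have h : Num.min d d' <= d /\ Num.min d d' <= d' by rewrite !ge_min !lexx orbT.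
  by case: h; move: r0; rewrite /r; norm_lra.
(* Near a the map f shrinks distances at most by the factor 2 k. *)
have inj_lip x y : mnorm (x - a) <= r -> mnorm (y - a) <= r ->
    mnorm (x - y) <= 2 * k * mnorm (f x - f y).
  move=> xr yr; have xd := le_lt_trans xr rd; have yd := le_lt_trans yr rd.
  have fxy := fd _ _ xd yd.
  have E : x - y = (f x - f y) *m J - (f x - f y - (x - y) *m L) *m J.
    by rewrite [X in _ = _ - X]mulmxBl subKr mulmxK.
  have := mnormD ((f x - f y) *m J) (- ((f x - f y - (x - y) *m L) *m J)).
  rewrite -E mnormN -mulrA => /half_absorb; apply; first exact: Jk.
  apply: le_trans (Jk _) _; apply: le_trans (ler_wpM2l (ltW k0) fxy) _.
  by rewrite mulrA (_ : k * (2 * k)^-1 = 2^-1) //; field; rewrite gt_eqF.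
pose rho := r / (2 * k).
have rho0 : 0 < rho by rewrite divr_gt0 // mulr_gt0.
have solve y : mnorm (y - f a) <= rho -> exists2 x, mnorm (x - a) <= r & f x = y.
  move=> yr; pose T x := x - (f x - y) *m J.
  have [x z xr yzr||x xr Tx] := @ball_fixed_point R n T a r (ltW r0).
  - have -> : T x - T z = - ((f x - f z - (x - z) *m L) *m J).
      have -> : (f x - f z - (x - z) *m L) *m J =
          (f x - y) *m J - (f z - y) *m J - (x - z).
        rewrite mulmxBl (mulmxK Lu) -(mulmxBl (f x - y)).
        by rewrite [f z - y]addrC addrKA.
      by rewrite /T !opprB addrACA [RHS]addrACA [- _ - z]addrC.
    rewrite mnormN; apply: le_trans (Jk _) _.
    have := fd _ _ (le_lt_trans xr rd) (le_lt_trans yzr rd).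
    move=> /(ler_wpM2l (ltW k0)) /le_trans; apply.
    by rewrite mulrA le_eqVlt; apply/orP; left; apply/eqP; field; rewrite gt_eqF.
  - rewrite /T addrC addKr -mulNmx opprB; apply: le_trans (Jk _) _.
    apply: le_trans (ler_wpM2l (ltW k0) yr) _; rewrite /rho.
    by rewrite le_eqVlt; apply/orP; left; apply/eqP; field; rewrite gt_eqF.
  exists x => //; apply/eqP; rewrite -subr_eq0; apply/eqP.
  rewrite -(mulmxKV Lu (f x - y)); have /eqP := Tx.
  rewrite -subr_eq0 /T addrC addKr oppr_eq0 => /eqP ->.
  by rewrite mul0mx.
have /choice [g gP] y : exists x, mnorm (y - f a) <= rho ->
    mnorm (x - a) <= r /\ f x = y.
  have [yr|yr] := boolP (mnorm (y - f a) <= rho); last by exists a.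
  by have [x] := solve y yr; exists x.
have far : mnorm (f a - f a) <= rho by rewrite subrr mnorm0 ltW.
have aar : mnorm (a - a) <= r by rewrite subrr mnorm0 ltW.
have gf x : mnorm (x - a) <= r -> mnorm (f x - f a) <= rho -> g (f x) = x.
  move=> xr fxr; have [gr fg] := gP _ fxr.
  apply/eqP; rewrite -subr_eq0; apply/eqP/mnorm0_eq0.
  apply: le_anti; rewrite mnorm_ge0 andbT.
  by have := inj_lip _ _ gr xr; rewrite fg subrr mnorm0 mulr0.
have near_fa e : 0 < e -> \forall y \near f a, mnorm (y - f a) < e.
  by move=> e0; apply/nbhs_mnormP; exists e.
have g_lip y z : mnorm (y - f a) <= rho -> mnorm (z - f a) <= rho ->
    mnorm (g y - g z) <= 2 * k * mnorm (y - z).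
  move=> /gP [gy fy] /gP [gz fz].
  by have := inj_lip _ _ gy gz; rewrite fy fz.
have gfa : g (f a) = a by apply: gf.
exists g; split=> //.
- have a1 : \forall x \near a, mnorm (x - a) < r by apply/nbhs_mnormP; exists r.
  have := strict_diff_near fL (near_fa _ rho0); move: a1; apply: filterS2 => x xr fxr.
  by apply: gf; apply: ltW.
- by have := near_fa _ rho0; apply: filterS => y /ltW /gP [].
have := near_fa _ rho0; apply: filterS => y yrho.
have gyr : mnorm (g y - a) < r.
  have := g_lip _ _ (ltW yrho) far; rewrite gfa => /le_lt_trans; apply.
  by rewrite -ltr_pdivlMl ?mulr_gt0 // mulrC.
have [L' fL'] : exists L', strict_diff f (g y) L'.
  by apply: fd'; apply: lt_trans rd'.
have fgy : f (g y) = y by have [] := gP y (ltW yrho).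
(* A kernel vector of the derivative at g y would contradict the lower bound for
   the distances of values of f. *)
have L'inj (v : 'rV[C]_n) : v *m L' = 0 -> v = 0.
  move=> vL'; have [|dl dl0 fdl] := fL' (4 * k)^-1.
    by rewrite invr_gt0 mulr_gt0.
  pose eta := Num.min dl (r - mnorm (g y - a)).
  have eta0 : 0 < eta by rewrite lt_min dl0 subr_gt0.
  have v1 : 0 < mnorm v + 1 by rewrite ltr_wpDl ?mnorm_ge0.
  pose t := eta / (mnorm v + 1); have t0 : 0 < t by rewrite divr_gt0.
  pose w : 'rV[C]_n := (t%:C%C : C) *: v.
  have wE : mnorm w = t * mnorm v.
    by rewrite mnormZ /cnorm normc_def /= expr0n addr0 sqrtr_sqr gtr0_norm.
  have weta : mnorm w < eta.
    rewrite wE /t mulrAC ltr_pdivrMr // ltr_pM2l //; norm_lra.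
  have [w1 w2] : mnorm w < dl /\ mnorm w < r - mnorm (g y - a).
    by move: weta; rewrite lt_min => /andP.
  have wr : mnorm (w + g y - a) <= r.
    by rewrite -addrA; have := mnormD w (g y - a); move: w2; norm_lra.
  have := inj_lip _ _ wr (ltW gyr); rewrite addrK.
  have := fdl (w + g y) (g y); rewrite addrK subrr mnorm0 => /(_ w1 dl0).
  have -> : w *m L' = 0 by rewrite -scalemxAl vL' scaler0.
  rewrite subr0 => h1 h2.
  have h3 : 2 * k * mnorm (f (w + g y) - f (g y)) <= 2^-1 * mnorm w.
    have k2 : 0 <= 2 * k by rewrite mulr_ge0 // ltW.
    apply: le_trans (ler_wpM2l k2 h1) _.
    by rewrite mulrA le_eqVlt; apply/orP; left; apply/eqP; field; rewrite gt_eqF.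
  have w0 : mnorm w = 0 by have := mnorm_ge0 w; move: h2 h3; norm_lra.
  apply: mnorm0_eq0; move/eqP: w0; rewrite wE mulf_eq0 (gt_eqF t0) /=.
  by move/eqP.
have L'u : L' \in unitmx.
  rewrite -row_free_unit -kermx_eq0; apply/eqP/row_matrixP => i.
  by rewrite row0; apply: L'inj; rewrite -row_mul mulmx_ker row0.
exists (invmx L') => e e0; have J0 := mxlip_gt0 (invmx L').
have [|dl dl0 fdl] := fL' (e / (2 * k * mxlip (invmx L'))).
  by rewrite divr_gt0 // !mulr_gt0.
have k2 : 0 < 2 * k by rewrite mulr_gt0.
exists (Num.min (rho - mnorm (y - f a)) (dl / (2 * k))) => [|z1 z2].
  by rewrite lt_min subr_gt0 yrho divr_gt0.
have in_rho z : mnorm (z - y) < rho - mnorm (y - f a) -> mnorm (z - f a) <= rho.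
  by move=> zy; rewrite -(subrKA y); have := mnormD (z - y) (y - f a); move: zy; norm_lra.
rewrite !lt_min !ltr_pdivlMr // ![_ * (2 * k)]mulrC.
move=> /andP[/in_rho r1 d1] /andP[/in_rho r2 d2].
have g1 := le_lt_trans (g_lip _ _ r1 (ltW yrho)) d1.
have g2 := le_lt_trans (g_lip _ _ r2 (ltW yrho)) d2.
have := fdl _ _ g1 g2; have [_ ->] := gP _ r1; have [_ ->] := gP _ r2.
move=> h; have g12 := g_lip _ _ r1 r2.
have -> : g z1 - g z2 - (z1 - z2) *m invmx L' =
    - ((z1 - z2 - (g z1 - g z2) *m L') *m invmx L').
  by rewrite [in RHS]mulmxBl mulmxK // opprB.
rewrite mnormN; apply: le_trans (mnorm_mulmx_lip _ _) _.
apply: le_trans (ler_wpM2l (ltW J0) h) _; rewrite mulrA.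
have E : e = mxlip (invmx L') * (e / (2 * k * mxlip (invmx L'))) * (2 * k).
  by field; rewrite !gt_eqF.
rewrite [X in _ <= X * _]E -[leRHS]mulrA; apply: ler_wpM2l g12.
exact: (ltW (mulr_gt0 J0 (divr_gt0 e0 (mulr_gt0 k2 J0)))).
Qed.

End InverseFunction.

(** * Rules for derivatives *)

Section ScalarDerivatives.
Variables (R : realType) (n : nat).
Local Notation C := (Cplx R).
Local Notation V := 'rV[C]_n.
Implicit Types (f g df dg : V -> C) (a : V).

(** [strict_diff] for scalar functions, with the derivative as a function, in
    which form it is computed by the rules below. *)
Definition has_deriv f a df :=
  (exists D : 'cV[C]_n, forall v, df v = (v *m D) 0 0) /\
  forall e : R, 0 < e -> exists2 d : R, 0 < d & forall x y,
    mnorm (x - a) < d -> mnorm (y - a) < d ->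
    cnorm (f x - f y - df (x - y)) <= e * mnorm (x - y).

Lemma has_deriv_lip f a df : has_deriv f a df ->
  exists K d : R, [/\ 0 < K, 0 < d & forall x y,
    mnorm (x - a) < d -> mnorm (y - a) < d ->
    cnorm (f x - f y) <= K * mnorm (x - y)].
Proof.
move=> [[D dfD] /(_ 1 ltr01) [d d0 fd]]; exists (1 + mxlip D), d.
split=> // [|x y xa ya]; first by rewrite ltr_wpDl // mxlip_gt0.
rewrite -(subrK (df (x - y)) (f x - f y)).
have := cnormD (f x - f y - df (x - y)) (df (x - y)).
have := fd _ _ xa ya; have := mnorm_mulmx_lip (x - y) D.
have := cnorm_entry ((x - y) *m D) 0 0; rewrite -dfD; norm_lra.
Qed.

Lemma has_deriv_const c a : has_deriv (fun=> c) a (fun=> 0).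
Proof.
split; first by exists 0 => v; rewrite mulmx0 mxE.
move=> e e0; exists 1 => // x y _ _.
by rewrite !subrr cnorm0 mulr_ge0 ?mnorm_ge0 // ltW.
Qed.

Lemma has_deriv_coord i a : has_deriv (fun x => x 0 i) a (fun v => v 0 i).
Proof.
split.
  by exists (delta_mx i 0) => v; rewrite -colE mxE.
move=> e e0; exists 1 => // x y _ _.
by rewrite !mxE subrr cnorm0 mulr_ge0 ?mnorm_ge0 // ltW.
Qed.

Lemma has_derivD f g a df dg : has_deriv f a df -> has_deriv g a dg ->
  has_deriv (fun x => f x + g x) a (fun v => df v + dg v).
Proof.
move=> [[D dfD] fd] [[E dgE] gd]; split.
  by exists (D + E) => v; rewrite mulmxDr mxE dfD dgE.
move=> e e0; have e2 : 0 < e / 2 by rewrite divr_gt0.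
have [d1 d10 fd1] := fd _ e2; have [d2 d20 gd2] := gd _ e2.
exists (Num.min d1 d2) => [|x y]; first by rewrite lt_min d10.
rewrite !lt_min => /andP[x1 x2] /andP[y1 y2].
have -> : f x + g x - (f y + g y) - (df (x - y) + dg (x - y)) =
  (f x - f y - df (x - y)) + (g x - g y - dg (x - y)) by ring.
have := cnormD (f x - f y - df (x - y)) (g x - g y - dg (x - y)).
have := fd1 _ _ x1 y1; have := gd2 _ _ x2 y2; norm_lra.
Qed.

Lemma has_derivM f g a df dg : has_deriv f a df -> has_deriv g a dg ->
  has_deriv (fun x => f x * g x) a (fun v => g a * df v + f a * dg v).
Proof.
move=> fd gd.
have [Kf [df0 [Kf0 df00 fK]]] := has_deriv_lip fd.
have [Kg [dg0 [Kg0 dg00 gK]]] := has_deriv_lip gd.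
move: fd gd => [[D dfD] fd] [[E dgE] gd]; split.
  exists (g a *: D + f a *: E) => v.
  by rewrite mulmxDr -!scalemxAr !mxE dfD dgE !mxE.
move=> e e0; pose M := cnorm (f a) + cnorm (g a) + 1.
have M0 : 0 < M by rewrite ltr_wpDl // addr_ge0 ?cnorm_ge0.
have [|d1 d10 fd1] := fd (e / (4 * M)); first by rewrite divr_gt0 ?mulr_gt0.
have [|d2 d20 gd2] := gd (e / (4 * M)); first by rewrite divr_gt0 ?mulr_gt0.
pose K := Kf * Kg; have K0 : 0 < K by rewrite mulr_gt0.
exists (Num.min (Num.min d1 d2) (Num.min (Num.min df0 dg0) (e / (4 * K)))).
  by rewrite !lt_min d10 d20 df00 dg00 divr_gt0 // mulr_gt0.
move=> x y; rewrite !lt_min => /andP[/andP[x1 x2] /andP[/andP[x3 x4] x5]].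
move=> /andP[/andP[y1 y2] /andP[/andP[y3 y4] y5]].
have aa1 : mnorm (a - a) < df0 by rewrite subrr mnorm0.
have aa2 : mnorm (a - a) < dg0 by rewrite subrr mnorm0.
set z := mnorm (x - y); have z0 : 0 <= z := mnorm_ge0 _.
have ineq (p q r s : R) : 0 <= p -> 0 <= r -> p <= q -> r <= s -> p * r <= q * s.
  by move=> *; apply: ler_pM.
pose r1 := f x - f y - df (x - y); pose r2 := g x - g y - dg (x - y).
(* The two remainders and two products of increments, each at most e / 4 times z. *)
have -> : f x * g x - f y * g y - (g a * df (x - y) + f a * dg (x - y)) =
    (r1 * g a + r2 * f a) + ((f x - f y) * (g x - g a) + (g x - g y) * (f y - f a)).
  by rewrite /r1 /r2; ring.
have b1 : cnorm (r1 * g a) <= e / 4 * z.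
  rewrite cnormM; apply: le_trans (ineq _ (e / (4 * M) * z) _ M _ _ _ _) _.
  - exact: cnorm_ge0.
  - exact: cnorm_ge0.
  - exact: fd1.
  - by have := cnorm_ge0 (f a); rewrite /M; norm_lra.
  by rewrite le_eqVlt; apply/orP; left; apply/eqP; field; rewrite gt_eqF.
have b2 : cnorm (r2 * f a) <= e / 4 * z.
  rewrite cnormM; apply: le_trans (ineq _ (e / (4 * M) * z) _ M _ _ _ _) _.
  - exact: cnorm_ge0.
  - exact: cnorm_ge0.
  - exact: gd2.
  - by have := cnorm_ge0 (g a); rewrite /M; norm_lra.
  by rewrite le_eqVlt; apply/orP; left; apply/eqP; field; rewrite gt_eqF.
have b3 : cnorm ((f x - f y) * (g x - g a)) <= e / 4 * z.
  rewrite cnormM.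
  apply: le_trans (ineq _ (Kf * z) _ (Kg * (e / (4 * K))) _ _ _ _) _.
  - exact: cnorm_ge0.
  - exact: cnorm_ge0.
  - exact: fK.
  - apply: le_trans (gK _ _ x4 aa2) _; apply: ler_wpM2l; exact: ltW.
  rewrite le_eqVlt; apply/orP; left; apply/eqP; rewrite /K; field.
  by rewrite !gt_eqF.
have b4 : cnorm ((g x - g y) * (f y - f a)) <= e / 4 * z.
  rewrite cnormM.
  apply: le_trans (ineq _ (Kg * z) _ (Kf * (e / (4 * K))) _ _ _ _) _.
  - exact: cnorm_ge0.
  - exact: cnorm_ge0.
  - exact: gK.
  - apply: le_trans (fK _ _ y3 aa1) _; apply: ler_wpM2l; exact: ltW.
  rewrite le_eqVlt; apply/orP; left; apply/eqP; rewrite /K; field.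
  by rewrite !gt_eqF.
have := cnormD (r1 * g a + r2 * f a)
  ((f x - f y) * (g x - g a) + (g x - g y) * (f y - f a)).
have := cnormD (r1 * g a) (r2 * f a).
have := cnormD ((f x - f y) * (g x - g a)) ((g x - g y) * (f y - f a)).
by move: b1 b2 b3 b4; norm_lra.
Qed.

Lemma cnorm_eq0 (z : C) : (cnorm z == 0) = (z == 0).
Proof.
apply/eqP/eqP => [z0|->]; last exact: cnorm0.
by apply: (@normr0_eq0 _ C); rewrite cnormE z0.
Qed.

Lemma cnormV (z : C) : cnorm (z^-1) = (cnorm z)^-1.
Proof.
have [->|z0] := eqVneq z 0; first by rewrite invr0 cnorm0 invr0.
have z1 : cnorm z != 0 by rewrite cnorm_eq0.
apply: (mulIf z1); rewrite -cnormM !mulVf //.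
by apply: (@complexI R); rewrite -cnormE normr1.
Qed.

Lemma has_derivV f a df : f a != 0 -> has_deriv f a df ->
  has_deriv (fun x => (f x)^-1) a (fun v => - (f a)^-2 * df v).
Proof.
move=> fa0 fd; have [K [d0 [K0 d00 fK]]] := has_deriv_lip fd.
move: fd => [[D dfD] fd]; split.
  by exists (- (f a)^-2 *: D) => v; rewrite -scalemxAr !mxE dfD mxE.
move=> e e0; pose al := cnorm (f a).
have al0 : 0 < al by rewrite lt_def cnorm_eq0 fa0 cnorm_ge0.
(* Where f is eta-close to f a, its modulus is at least al / 2; the constant 20
   makes the main error term K * (5 / 2 * al * eta) * (4 / al ^ 4) at most e / 2. *)
pose eta := Num.min (al / 2) (e * al ^+ 3 / (20 * K)).
have eta0 : 0 < eta.
  by rewrite lt_min !divr_gt0 ?mulr_gt0 ?exprn_gt0.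
have [eta1 eta2] : eta <= al / 2 /\ eta <= e * al ^+ 3 / (20 * K).
  by split; rewrite ge_min lexx ?orbT.
have [|d1 d10 fd1] := fd (e / 2 * al ^+ 2); first by rewrite mulr_gt0 ?exprn_gt0 ?divr_gt0.
exists (Num.min d0 (Num.min d1 (eta / K))) => [|x y].
  by rewrite !lt_min d00 d10 divr_gt0.
rewrite !lt_min !ltr_pdivlMr // ![_ * K]mulrC.
move=> /and3P[x0 x1 x2] /and3P[y0 y1 y2].
have aa : mnorm (a - a) < d0 by rewrite subrr mnorm0.
have close z : mnorm (z - a) < d0 -> K * mnorm (z - a) < eta ->
    cnorm (f z - f a) <= eta /\ al / 2 <= cnorm (f z).
  move=> z0 z1; have fz : cnorm (f z - f a) <= eta.
    by apply: le_trans (ltW z1); apply: fK.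
  split=> //; have := cnormD (f z) (f a - f z); rewrite [f z + _]addrC subrK.
  have -> : cnorm (f a - f z) = cnorm (f z - f a) by rewrite /cnorm distrC.
  by move: fz eta1; rewrite -/al; norm_lra.
have [fx px] := close x x0 x2; have [fy qy] := close y y0 y2.
have al2 : 0 < al / 2 by rewrite divr_gt0.
have fxn0 : f x != 0 by rewrite -cnorm_eq0 gt_eqF // (lt_le_trans al2).
have fyn0 : f y != 0 by rewrite -cnorm_eq0 gt_eqF // (lt_le_trans al2).
set z := mnorm (x - y); have z0 : 0 <= z := mnorm_ge0 _.
pose r1 := f x - f y - df (x - y).
(* This is f a ^ 2 - f x * f y. *)
pose W := f a * (f a - f x) + f x * (f a - f y).
have -> : (f x)^-1 - (f y)^-1 - - (f a)^-2 * df (x - y) =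
    - ((f x - f y) * (W * ((f x)^-1 * (f y)^-1 * (f a)^-2))) - r1 * (f a)^-2.
  by rewrite /r1 /W; field; rewrite ?fa0 ?fxn0 ?fyn0.
have cN (u : C) : cnorm (- u) = cnorm u by rewrite /cnorm normrN.
have caV : cnorm ((f a)^-2) = al ^- 2 by rewrite cnormV expr2 cnormM.
have bW : cnorm W <= 5 / 2 * al * eta.
  apply: le_trans (cnormD _ _) _; rewrite !cnormM -/al.
  have -> : cnorm (f a - f x) = cnorm (f x - f a) by rewrite /cnorm distrC.
  have -> : cnorm (f a - f y) = cnorm (f y - f a) by rewrite /cnorm distrC.
  have fx' : cnorm (f x) <= 3 / 2 * al.
    by have := cnormD (f x - f a) (f a); move: fx eta1; rewrite subrK -/al; norm_lra.
  have h1 : al * cnorm (f x - f a) <= al * eta by rewrite ler_wpM2l // ltW.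
  have h2 : cnorm (f x) * cnorm (f y - f a) <= 3 / 2 * al * eta.
    by apply: ler_pM => //; apply: cnorm_ge0.
  by move: h1 h2; norm_lra.
have bV : cnorm ((f x)^-1 * (f y)^-1 * (f a)^-2) <= 4 / al ^+ 4.
  rewrite !cnormM caV !cnormV.
  have iv u : al / 2 <= u -> u^-1 <= 2 / al.
    by move=> au; rewrite -[2 / al]invf_div lef_pV2 // posrE (lt_le_trans al2).
  have -> : 4 / al ^+ 4 = 2 / al * (2 / al) * al ^- 2 by field; rewrite gt_eqF.
  apply: ler_wpM2r; first by rewrite invr_ge0 exprn_ge0 // ltW.
  by apply: ler_pM; rewrite ?invr_ge0 ?cnorm_ge0 // iv.
have b1 : cnorm ((f x - f y) * (W * ((f x)^-1 * (f y)^-1 * (f a)^-2))) <= e / 2 * z.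
  rewrite cnormM [cnorm (W * _)]cnormM.
  apply: (@le_trans _ _ ((K * z) * ((5 / 2 * al * eta) * (4 / al ^+ 4)))).
    apply: ler_pM; rewrite ?mulr_ge0 ?cnorm_ge0 //; first exact: fK.
    by apply: ler_pM; rewrite ?cnorm_ge0.
  apply: (@le_trans _ _ ((K * z) * ((5 / 2 * al * (e * al ^+ 3 / (20 * K))) * (4 / al ^+ 4)))).
    apply: ler_wpM2l; first by rewrite mulr_ge0 // ltW.
    apply: ler_wpM2r; first by rewrite divr_ge0 ?exprn_ge0 // ltW.
    by apply: ler_wpM2l => //; rewrite mulr_ge0 // ltW.
  by rewrite le_eqVlt; apply/orP; left; apply/eqP; field; rewrite !gt_eqF.
have b2 : cnorm (r1 * (f a)^-2) <= e / 2 * z.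
  rewrite cnormM caV ler_pdivrMr ?exprn_gt0 //.
  by rewrite mulrAC; apply: fd1.
have := cnormD (- ((f x - f y) * (W * ((f x)^-1 * (f y)^-1 * (f a)^-2))))
  (- (r1 * (f a)^-2)); rewrite !cN; move: b1 b2; norm_lra.
Qed.

(** Stable under sums, products and inverses, and strong enough for the
    inverse function theorem and for holomorphy. *)
Definition deriv_near f a := \forall x \near a, exists df, has_deriv f x df.

End ScalarDerivatives.

Section DerivativeRules.
Variables (R : realType) (n : nat).
Local Notation C := (Cplx R).
Local Notation V := 'rV[C]_n.
Implicit Types (f g df dg : V -> C) (a : V).

Lemma has_deriv_eq f a df dg : has_deriv f a df -> df =1 dg -> has_deriv f a dg.
Proof. by move=> fd /funext <-. Qed.

Lemma has_derivN f a df : has_deriv f a df ->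
  has_deriv (fun x => - f x) a (fun v => - df v).
Proof.
move=> [[D dfD] fd]; split; first by exists (- D) => v; rewrite mulmxN mxE dfD.
move=> e /fd [d d0 fdd]; exists d => // x y xa ya.
rewrite -!opprD; have -> (z : C) : cnorm (- z) = cnorm z by rewrite /cnorm normrN.
exact: fdd.
Qed.

Lemma has_derivB f g a df dg : has_deriv f a df -> has_deriv g a dg ->
  has_deriv (fun x => f x - g x) a (fun v => df v - dg v).
Proof. by move=> fd gd; apply: has_derivD => //; apply: has_derivN. Qed.

Lemma has_deriv_horner (p : {poly C}) f a df : has_deriv f a df ->
  has_deriv (fun x => p.[f x]) a (fun v => p^`().[f a] * df v).
Proof.
move=> fd; elim/poly_ind: p => [|p c IH].
  rewrite (_ : (fun x => _) = fun=> 0); last by apply/funext => x; rewrite horner0.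
  apply: has_deriv_eq (has_deriv_const 0 a) _ => v.
  by rewrite deriv0 horner0 mul0r.
rewrite (_ : (fun x => _) = fun x => p.[f x] * f x + c); last first.
  by apply/funext => x; rewrite hornerMXaddC.
have := has_derivD (has_derivM IH fd) (has_deriv_const c a).
move=> /has_deriv_eq; apply=> v.
by rewrite derivMXaddC hornerD hornerMX; ring.
Qed.

Lemma has_derivX m f a df : has_deriv f a df ->
  has_deriv (fun x => f x ^+ m) a (fun v => (f a ^+ m.-1 *+ m) * df v).
Proof.
move=> /(has_deriv_horner 'X^m).
rewrite (_ : (fun x => _) = fun x => f x ^+ m); last first.
  by apply/funext => x; rewrite hornerXn.
by move=> /has_deriv_eq; apply=> v; rewrite derivXn hornerMn hornerXn.
Qed.

Lemma has_deriv_near_neq0 f a df : has_deriv f a df -> f a != 0 ->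
  \forall x \near a, f x != 0.
Proof.
move=> /has_deriv_lip [K [d [K0 d0 fK]]] fa0.
have al0 : 0 < cnorm (f a) by rewrite lt_def cnorm_eq0 fa0 cnorm_ge0.
apply/nbhs_mnormP; exists (Num.min d (cnorm (f a) / K)) => [|x].
  by rewrite lt_min d0 divr_gt0.
rewrite lt_min ltr_pdivlMr // mulrC => /andP[xd xK].
apply: contraTneq xK => fx; rewrite -leNgt.
by have := fK a x; rewrite subrr mnorm0 fx subr0 (mnormBC a x) => /(_ d0 xd).
Qed.

Lemma deriv_near_const c a : deriv_near (fun=> c) a.
Proof. apply/nbhs_mnormP; exists 1 => // x _.
by exists (fun=> 0); apply: has_deriv_const. Qed.

Lemma deriv_near_coord i a : deriv_near (fun x => x 0 i) a.
Proof. apply/nbhs_mnormP; exists 1 => // x _.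
by exists (fun v => v 0 i); apply: has_deriv_coord. Qed.

Lemma deriv_nearD f g a : deriv_near f a -> deriv_near g a ->
  deriv_near (fun x => f x + g x) a.
Proof.
apply: filterS2 => x [df fd] [dg gd].
by exists (fun v => df v + dg v); apply: has_derivD.
Qed.

Lemma deriv_nearN f a : deriv_near f a -> deriv_near (fun x => - f x) a.
Proof.
by apply: filterS => x [df fd]; exists (fun v => - df v); apply: has_derivN.
Qed.

Lemma deriv_nearB f g a : deriv_near f a -> deriv_near g a ->
  deriv_near (fun x => f x - g x) a.
Proof. by move=> fd gd; apply: deriv_nearD => //; apply: deriv_nearN. Qed.

Lemma deriv_nearM f g a : deriv_near f a -> deriv_near g a ->
  deriv_near (fun x => f x * g x) a.
Proof.
apply: filterS2 => x [df fd] [dg gd].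
by exists (fun v => g x * df v + f x * dg v); apply: has_derivM.
Qed.

Lemma deriv_near_horner (p : {poly C}) f a : deriv_near f a ->
  deriv_near (fun x => p.[f x]) a.
Proof.
apply: filterS => x [df fd]; exists (fun v => p^`().[f x] * df v).
exact: has_deriv_horner.
Qed.

Lemma deriv_nearX m f a : deriv_near f a -> deriv_near (fun x => f x ^+ m) a.
Proof.
apply: filterS => x [df fd]; exists (fun v => (f x ^+ m.-1 *+ m) * df v).
exact: has_derivX.
Qed.

Lemma deriv_nearV f a : f a != 0 -> deriv_near f a ->
  deriv_near (fun x => (f x)^-1) a.
Proof.
move=> fa0 fn; have [df fd] := nbhs_singleton fn.
move: (has_deriv_near_neq0 fd fa0) fn; apply: filterS2 => x fx0 [dg gd].
by exists (fun v => - (f x)^-2 * dg v); apply: has_derivV.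
Qed.

Lemma strict_diff_row p (F dF : 'I_p -> V -> C) a :
  (forall j, has_deriv (F j) a (dF j)) ->
  exists2 L, strict_diff (fun x => \row_j F j x) a L &
    forall v, v *m L = \row_j dF j v.
Proof.
move=> Fd; have /choice [D DP] j : exists D : 'cV[C]_n, forall v, dF j v = (v *m D) 0 0.
  by case: (Fd j).
pose L : 'M[C]_(n, p) := \matrix_(i, j) D j i 0.
have LE v : v *m L = \row_j dF j v.
  by apply/rowP => j; rewrite !mxE DP mxE; apply: eq_bigr => i _; rewrite mxE.
exists L => // e e0.
have /choice [d dP] j : exists d : R, 0 < d /\ forall x y,
    mnorm (x - a) < d -> mnorm (y - a) < d ->
    cnorm (F j x - F j y - dF j (x - y)) <= e * mnorm (x - y).
  by case: (Fd j) => _ /(_ e e0) [d d0 dP]; exists d.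
exists (\big[Num.min/1]_j d j) => [|x y].
  by apply/bigmin_gtP; split=> // j _; have [] := dP j.
move=> /bigmin_gtP [_ xd] /bigmin_gtP [_ yd].
apply: mnorm_le => [|i j]; first by rewrite mulr_ge0 ?mnorm_ge0 // ltW.
rewrite LE !mxE; have [_] := dP j; apply; [exact: xd|exact: yd].
Qed.

Lemma strictly_diff_near_row p (F : 'I_p -> V -> C) (a : V) :
  (forall j, deriv_near (F j) a) ->
  strictly_diff_near (fun x => \row_j F j x) a.
Proof.
move=> Fd; have : \forall x \near a, forall j, exists df, has_deriv (F j) x df.
  exact: (@filter_forall _ _ (fun j x => exists df, has_deriv (F j) x df)
    (nbhs a) (nbhs_filter a) Fd).
apply: filterS => x /choice [dF dFP].
by have [L LP _] := strict_diff_row dFP; exists L.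
Qed.

End DerivativeRules.

(** * Equivalence of germs *)

Section Charts.
Variable R : realType.
Local Notation C := (Cplx R).
Local Notation V := 'rV[C]_3.

Lemma strictly_diff_holomorphic (f : V -> V) a :
  strictly_diff_near f a -> holomorphic_at f a.
Proof. by apply: filterS => x [L]; apply: strict_diff_differentiable. Qed.

(** If two local coordinate systems [tau] and [kappa] at [c] pull back [F] and
    [G] to the same function up to a unit, then [tau \o kappa^-1] is an
    equivalence of the germs. *)
Lemma equivalent_by_charts (F G : V -> C) (tau kappa : V -> V) (c : V)
    (u : V -> C^o) Lt Lk :
  strict_diff tau c Lt -> Lt \in unitmx -> strictly_diff_near tau c ->
  strict_diff kappa c Lk -> Lk \in unitmx -> strictly_diff_near kappa c ->
  holomorphic_at u (kappa c) -> u (kappa c) != 0 ->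
  (\forall x \near c, F (tau x) = u (kappa x) * G (kappa x)) ->
  analytically_equivalent F (tau c) G (kappa c).
Proof.
move=> tL tu tn kL ku kn hu u0 FG.
have [ti [tic tiK tKi tin]] := local_inverse tL tu tn.
have [ki [kic kiK kKi kin]] := local_inverse kL ku kn.
have [Lti tiL] := nbhs_singleton tin; have [Lki kiL] := nbhs_singleton kin.
exists (tau \o ki), (kappa \o ti), u; split=> //=.
- by rewrite kic.
- split; apply: strictly_diff_holomorphic.
    by apply: (strictly_diff_near_comp kin); rewrite kic.
  by apply: (strictly_diff_near_comp tin); rewrite tic.
- split.
    have := @strict_diff_near _ _ _ _ _ _ (fun x => ti (tau x) = x) kiL.
    rewrite kic => /(_ tiK); move: kKi; apply: filterS2 => x kx tx.
    by rewrite tx.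
  have := @strict_diff_near _ _ _ _ _ _ (fun x => ki (kappa x) = x) tiL.
  rewrite tic => /(_ kiK); move: tKi; apply: filterS2 => x kx tx.
  by rewrite tx.
have := strict_diff_near kiL; rewrite kic => /(_ _ FG).
by move: kKi; apply: filterS2 => x kx ->; rewrite kx.
Qed.

End Charts.

(** * The folding polynomial and its homogenization *)

Section PowerSums.

(** Three consecutive power sums of three variables, by Newton's recursion in
    their elementary symmetric functions [x], [y], [t]. *)
Fixpoint psums (A : nzRingType) (x y t : A) d : A * A * A :=
  if d is d'.+1 then
    let: (a, b, c) := psums x y t d' in (b, c, x * c - y * b + t * a)
  else (3%:R, x, x ^+ 2 - y *+ 2).

Definition psum (A : nzRingType) (x y t : A) d := (psums x y t d).1.1.

Lemma psums_ind (A : nzRingType) (x y t : A) (P : nat -> A -> Prop) :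
  P 0%N 3%:R -> P 1%N x -> P 2%N (x ^+ 2 - y *+ 2) ->
  (forall d a b c, P d a -> P d.+1 b -> P d.+2 c ->
     P d.+3 (x * c - y * b + t * a)) ->
  forall d, P d (psum x y t d).
Proof.
move=> P0 P1 P2 PS d.
suff [] : [/\ P d (psums x y t d).1.1, P d.+1 (psums x y t d).1.2 &
  P d.+2 (psums x y t d).2] by [].
elim: d => [|d] //=; case: (psums x y t d) => [[a b] c] /= [Pa Pb Pc].
by split=> //; apply: PS.
Qed.

Lemma psum_elementary (A : comNzRingType) (u1 u2 u3 : A) d :
  psum (u1 + u2 + u3) (u1 * u2 + u1 * u3 + u2 * u3) (u1 * u2 * u3) d =
  u1 ^+ d + u2 ^+ d + u3 ^+ d.
Proof.
move: d; apply: (@psums_ind _ _ _ _ (fun d p => p = u1 ^+ d + u2 ^+ d + u3 ^+ d))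
  => [|||d a b c -> -> ->].
- by rewrite !expr0; ring.
- by [].
- by ring.
by rewrite !exprS; ring.
Qed.

Lemma psum_rmorph (A B : nzRingType) (phi : {rmorphism A -> B}) x y t d :
  phi (psum x y t d) = psum (phi x) (phi y) (phi t) d.
Proof.
suff : forall d, let: (a, b, c) := psums x y t d in
  psums (phi x) (phi y) (phi t) d = (phi a, phi b, phi c).
  by move=> /(_ d); rewrite /psum; case: (psums x y t d) => [[a b] c] ->.
elim=> [|e] /=; first by rewrite rmorph_nat rmorphB rmorphXn rmorphMn.
case: (psums x y t e) => [[a b] c] ->.
by rewrite rmorphD rmorphB !rmorphM.
Qed.

Lemma psum_pow (A : comNzRingType) (x : A) d : (0 < d)%N ->
  psum x 0 0 d = x ^+ d.
Proof.
move=> d0; have := psum_elementary x 0 0 d.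
by rewrite !mulr0 !addr0 expr0n gtn_eqF // !addr0.
Qed.

End PowerSums.

Section Form.
Variables (K : numClosedFieldType) (w : K) (g : {poly K}) (d : nat).
Hypotheses (w0 : w != 0) (d0 : (0 < d)%N).

Local Notation A := (mpoly 4 K).
Local Notation X j := (mpolyX K (mnm1 (lift (@ord_max 3) (j : 'I_3))) : A).
Local Notation W := (mpolyX K (mnm1 (@ord_max 3)) : A).

(** The form of degree [d] whose value for [W = 1] is
    [w p(x, y) + w^2 p(y, x) + 2 + g(z)], where [p] is the power sum for
    [u1 u2 u3 = 1]. The weights [1], [2], [3] of the elementary symmetric functions
    are made up for by powers of [W]. *)
Definition fold_form : A :=
  w *: psum (X 0) (X 1 * W) (W ^+ 3) d + w ^+ 2 *: psum (X 1) (X 0 * W) (W ^+ 3) d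
  + 2 *: W ^+ d + \sum_(i < d.+1) g`_i *: (X 2 ^+ i * W ^+ (d - i)).

Let homX i : mpolyX K (mnm1 i) \is @ishomog1 4 K 1 mdeg.
Proof. by rewrite dhomogX; apply/eqP; apply: mdeg1. Qed.

Let homXn i e : mpolyX K (mnm1 i) ^+ e \is @ishomog1 4 K e mdeg.
Proof. by have := dhomogMn e (homX i); rewrite mul1n. Qed.

Let hom_psum i j e :
  psum (mpolyX K (mnm1 i) : A) (mpolyX K (mnm1 j) * W) (W ^+ 3) e
    \is @ishomog1 4 K e mdeg.
Proof.
move: e; apply: (@psums_ind _ _ _ _ (fun e p => p \is @ishomog1 4 K e mdeg)).
- by rewrite -(mulr1 3%:R) mulr_natl rpredMn // dhomog1.
- exact: homX.
- by rewrite rpredB ?rpredMn //; [exact: homXn|exact: (dhomogM (homX j) (homX _))].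
move=> e a b c ha hb hc; rewrite rpredD //; last exact: (dhomogM (homXn _ 3)).
rewrite rpredB //; first exact: (dhomogM (homX i)).
exact: (dhomogM (dhomogM (homX j) (homX _))).
Qed.

Lemma fold_form_homog : fold_form \is ishomog1 d mdeg.
Proof.
rewrite /fold_form !rpredD ?rpredZ ?homXn ?hom_psum //.
apply: rpred_sum => i _; rewrite rpredZ //.
have := dhomogM (homXn (lift (@ord_max 3) (2 : 'I_3)) i) (homXn (@ord_max 3) (d - i)).
by rewrite subnKC // -ltnS.
Qed.

Lemma fold_form_eval (v : 'I_4 -> K) : (size g <= d.+1)%N -> v ord_max = 1 ->
  let x := v (lift ord_max (0 : 'I_3)) in let y := v (lift ord_max (1 : 'I_3)) in
  let z := v (lift ord_max (2 : 'I_3)) in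
  meval v fold_form = w * psum x y 1 d + w ^+ 2 * psum y x 1 d + 2 + g.[z].
Proof.
move=> sg v1 x y z.
rewrite /fold_form !mevalD !mevalZ !(psum_rmorph (meval v)) !rmorphXn /= !mevalM.
rewrite !mevalXU v1 !mulr1 !expr1n mulr1; congr (_ + _).
rewrite raddf_sum (horner_coef_wide _ sg); apply: eq_bigr => i _.
by rewrite /= mevalZ rmorphM !rmorphXn /= !mevalXU v1 expr1n mulr1.
Qed.

(* The restriction to the line (t, 1, 0, 0). *)
Let h (i : 'I_4) : {poly K} :=
  if i == lift ord_max (0 : 'I_3) then 'X
  else if i == lift ord_max (1 : 'I_3) then 1 else 0.
Let line (p : A) : {poly K} := mmap (@polyC K) h p.

Let size_line p : (size (line p) <= mmeasure mdeg p)%N.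
Proof.
rewrite /line /mmap; apply: leq_trans (size_sum _ _ _) _.
apply/bigmax_leqP_seq => m mp _; apply: leq_trans (msize_mdeg_lt mp).
rewrite mul_polyC; apply: leq_trans (size_scale_leq _ _) _.
rewrite /mmap1 mdegE.
elim/big_ind2: _ => [|p1 a q b pa qb|i _]; first by rewrite size_poly1.
  apply: leq_trans (size_polyMleq _ _) _; rewrite -ltnS.
  by case: (size p1) (size q) pa qb => [|?] [|?]; lia.
apply: leq_trans (size_poly_exp_leq _ _) _; rewrite ltnS -[leqRHS]mul1n leq_mul2r.
apply/orP; right; rewrite /h; case: ifP => _; first by rewrite size_polyX.
by case: ifP => _; rewrite ?size_poly1 ?size_poly0.
Qed.

Let lineM p q : line (p * q) = line p * line q.
Proof. exact: (rmorphM (mmap (@polyC K) h)). Qed.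

Let line_form : line fold_form = w *: 'X^d + (w ^+ 2)%:P.
Proof.
pose phi : {rmorphism A -> {poly K}} := mmap (@polyC K) h.
have X0 : phi (X 0) = 'X by rewrite /= mmapX mmap1U /h eqxx.
have X1 : phi (X 1) = 1 by rewrite /= mmapX mmap1U /h.
have X2 : phi (X 2) = 0 by rewrite /= mmapX mmap1U /h.
have XW : phi W = 0 by rewrite /= mmapX mmap1U /h.
have phiZ c p : phi (c *: p) = c *: phi p by rewrite /= mmapZ mul_polyC.
rewrite -[line _]/(phi _) /fold_form !rmorphD !phiZ !psum_rmorph !rmorphXn !rmorphM.
rewrite X0 X1 XW !mulr0 !expr0n (gtn_eqF d0) /= !psum_pow //.
rewrite scaler0 addr0 expr1n alg_polyC rmorph_sum [Y in _ + Y]big1 => [|i _].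
  by rewrite addr0 polyC_exp.
rewrite phiZ rmorphM !rmorphXn X2 XW !expr0n.
have [->|i0] := eqVneq (i : nat) 0%N; last by rewrite mul0r scaler0.
by rewrite subn0 (gtn_eqF d0) mulr0 scaler0.
Qed.

Let size_line_form : size (line fold_form) = d.+1.
Proof.
rewrite line_form size_polyDl size_scale // size_polyXn //.
by rewrite (leq_ltn_trans (size_polyC_leq1 _)).
Qed.

Lemma fold_form_neq0 : fold_form != 0.
Proof.
apply/eqP => F0; have := size_line_form.
by rewrite F0 /line mmap0 size_poly0.
Qed.

(** On the line [(t, 1, 0, 0)] the form restricts to the separable polynomial
    [w * t ^ d + w ^ 2] of the full degree [d], so that a square factor would
    be constant on the line, hence constant. *)
Lemma fold_form_squarefree (p q : A) : fold_form = p ^+ 2 * q ->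
  exists c, p = mpolyC 4 c.
Proof.
move=> Fpq; have F0 := fold_form_neq0.
have [p0 q0] : p != 0 /\ q != 0.
  by split; apply: contraNneq F0 => E; rewrite Fpq E ?mulr0 // expr0n mul0r.
have lF := size_line_form; rewrite Fpq lineM expr2 lineM in lF.
have lpq0 : line p * line p * line q != 0 by rewrite -size_poly_eq0 lF.
have [lp0 lq0] : line p != 0 /\ line q != 0.
  by split; apply: contraNneq lpq0 => ->; rewrite ?mulr0 ?mul0r.
have mF : mmeasure mdeg fold_form = d.+1.
  rewrite (mpolySpred mdeg F0); congr _.+1; apply/esym.
  exact: (dhomog_uniq F0 fold_form_homog (dhomog_msize fold_form_homog)).
have slp : size (line p) = mmeasure mdeg p.
  move: mF lF; rewrite Fpq expr2 !msizeM ?mulf_neq0 // !size_mul ?mulf_neq0 //.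
  have := size_line p; have := size_line q.
  have := mpolySpred mdeg p0; have := mpolySpred mdeg q0.
  have := polySpred lp0; have := polySpred lq0.
  move: (size (line p)) (size (line q)) (mmeasure _ p) (mmeasure _ q).
  move=> a b a' b'; lia.
have : size (line p) == 1%N.
  apply/negPn/negP => /closed_rootP [r pr].
  have := line_form; rewrite Fpq expr2 !lineM => E.
  have r1 : root (w *: 'X^d + (w ^+ 2)%:P) r by rewrite -E !rootM pr.
  have r2 : root (w *: 'X^d + (w ^+ 2)%:P)^`() r.
    by rewrite -E !derivM rootE !(hornerD, hornerM) (eqP pr) !(mul0r, mulr0, add0r).
  move: r2; rewrite rootE derivD derivZ derivXn derivC addr0 hornerZ hornerMn hornerXn.
  rewrite mulf_eq0 (negPf w0) mulrn_eq0 (gtn_eqF d0) /= => /eqP rd.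
  move: r1; rewrite rootE hornerD hornerZ hornerXn hornerC -(prednK d0) exprS rd.
  by rewrite !mulr0 add0r expf_eq0 (negPf w0).
rewrite slp => /eqP s1; exists (mcoeff (@mnm0 4) p); apply: msize1_polyC.
by rewrite s1.
Qed.

End Form.

(** * Singularities of type A *)

Section Nodes.
Variable R : realType.
Local Notation C := (Cplx R).
Local Notation V := 'rV[C]_3.

Definition vec3 (a b c : C) : V :=
  \row_j (if j == 0 then a else if j == 1 then b else c).

Lemma injective_unitmx n (L : 'M[C]_n) :
  (forall v : 'rV[C]_n, v *m L = 0 -> v = 0) -> L \in unitmx.
Proof.
move=> Linj; rewrite -row_free_unit -kermx_eq0; apply/eqP/row_matrixP => i.
by rewrite row0; apply: Linj; rewrite -row_mul mulmx_ker row0.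
Qed.

Lemma vec3_chart (f0 f1 f2 df0 df1 df2 : V -> C) c :
  has_deriv f0 c df0 -> has_deriv f1 c df1 -> has_deriv f2 c df2 ->
  deriv_near f0 c -> deriv_near f1 c -> deriv_near f2 c ->
  (forall v, df0 v = 0 -> df1 v = 0 -> df2 v = 0 -> v = 0) ->
  exists L, [/\ strict_diff (fun x => vec3 (f0 x) (f1 x) (f2 x)) c L,
    L \in unitmx & strictly_diff_near (fun x => vec3 (f0 x) (f1 x) (f2 x)) c].
Proof.
move=> d0 d1 d2 n0 n1 n2 inj.
pose F (j : 'I_3) x := if j == 0 then f0 x else if j == 1 then f1 x else f2 x.
pose dF (j : 'I_3) v := if j == 0 then df0 v else if j == 1 then df1 v else df2 v.
have [j|L FL LE] := @strict_diff_row R 3 3 F dF c.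
  by rewrite /F /dF; case: (j == 0) => //; case: (j == 1).
exists L; split=> //.
  apply: injective_unitmx => v; rewrite LE => /rowP v0.
  by apply: inj; [have := v0 0|have := v0 1|have := v0 2]; rewrite !mxE.
apply: (@strictly_diff_near_row R 3 3 F) => j.
by rewrite /F; case: (j == 0) => //; case: (j == 1).
Qed.

Lemma holomorphic_scalar (u : V -> C) (a : V) :
  deriv_near u a -> holomorphic_at (u : V -> C^o) a.
Proof.
apply: filterS => x [du ux].
have [j|L uL _] := @strict_diff_row R 3 1 (fun=> u) (fun=> du) x; first exact: ux.
have := strict_diff_differentiable uL => ud.
have -> : u = (fun M : 'rV[C]_1 => M 0 0 : C^o) \o (fun y => \row_(j < 1) u y).
  by apply/funext => y; rewrite /= mxE.
by apply: differentiable_comp => //; apply: differentiable_coord.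
Qed.

(** The elementary symmetric functions of [u1 = s], [u2 = t],
    [u3 = (s t)^-1], next to the coordinate [z]. *)
Definition tau (x : V) : V :=
  vec3 (x 0 0 + x 0 1 + (x 0 0 * x 0 1)^-1)
       (x 0 0 * x 0 1 + (x 0 0)^-1 + (x 0 1)^-1) (x 0 2).

(** The Jacobian determinant of the elementary symmetric functions is the
    Vandermonde determinant [(u1 - u2) (u1 - u3) (u2 - u3)], up to a factor
    without zeros on the torus. *)
Lemma tau_chart (c : V) : c 0 0 != 0 -> c 0 1 != 0 -> c 0 0 != c 0 1 ->
  c 0 0 ^+ 2 * c 0 1 != 1 -> c 0 0 * c 0 1 ^+ 2 != 1 ->
  exists L, [/\ strict_diff tau c L, L \in unitmx & strictly_diff_near tau c].
Proof.
move=> s0 t0 st st1 st2.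
have ds := has_deriv_coord (0 : 'I_3) c; have dt := has_deriv_coord (1 : 'I_3) c.
have dz := has_deriv_coord (2 : 'I_3) c.
have ns := deriv_near_coord (0 : 'I_3) c; have nt := deriv_near_coord (1 : 'I_3) c.
have nz := deriv_near_coord (2 : 'I_3) c.
have stn0 : c 0 0 * c 0 1 != 0 by rewrite mulf_neq0.
apply: (vec3_chart (has_derivD (has_derivD ds dt) (has_derivV stn0 (has_derivM ds dt)))
  (has_derivD (has_derivD (has_derivM ds dt) (has_derivV s0 ds)) (has_derivV t0 dt)) dz).
- apply: deriv_nearD; first exact: deriv_nearD.
  by apply: deriv_nearV => //; apply: deriv_nearM.
- apply: deriv_nearD; last exact: deriv_nearV.
  by apply: deriv_nearD; [apply: deriv_nearM|apply: deriv_nearV].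
- by [].
move=> v; set s := c 0 0 in s0 st st1 st2 stn0 *; set t := c 0 1 in t0 st st1 st2 stn0 *.
set v0 := v 0 0; set v1 := v 0 1 => E1 E2 E3.
have {}E1 : (s ^+ 2 * t - 1) * t * v0 + (s * t ^+ 2 - 1) * s * v1 = 0.
  by rewrite -(mulr0 (s ^+ 2 * t ^+ 2)) -E1; field; rewrite s0 t0.
have {}E2 : (s ^+ 2 * t - 1) * t ^+ 2 * v0 + (s * t ^+ 2 - 1) * s ^+ 2 * v1 = 0.
  by rewrite -(mulr0 (s ^+ 2 * t ^+ 2)) -E2; field; rewrite s0 t0.
have st0 : s - t != 0 by rewrite subr_eq0.
have a0 : s ^+ 2 * t - 1 != 0 by rewrite subr_eq0.
have b0 : s * t ^+ 2 - 1 != 0 by rewrite subr_eq0.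
have v00 : v0 = 0.
  have : (s ^+ 2 * t - 1) * t * (s - t) * v0 = 0.
    by rewrite -[RHS](subr0 0) -{1}(mulr0 s) -{1}E1 -E2; ring.
  by move/eqP; rewrite !mulf_eq0 (negPf a0) (negPf t0) (negPf st0) => /eqP.
have v10 : v1 = 0.
  by move/eqP: E1; rewrite v00 mulr0 add0r !mulf_eq0 (negPf b0) (negPf s0) => /eqP.
apply/rowP => j; rewrite mxE; case: j => [[|[|[|//]]]] lt.
- by rewrite -[RHS]v00 /v0; congr (v _ _); apply: val_inj.
- by rewrite -[RHS]v10 /v1; congr (v _ _); apply: val_inj.
- by rewrite -[RHS]E3; congr (v _ _); apply: val_inj.
Qed.

(** In the coordinates [X = (A / Q + B) / 2], [Y = (A / Q - B) / (2 i)],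
    [Z = z - p] the function [A B + (z - p) ^ (nu + 1) Q] is [Q] times the normal
    form. *)
Lemma node_equivalence nu (F : V -> C) (c : V) (A B dA dB : V -> C)
    (Q : {poly C}) :
  c 0 0 != 0 -> c 0 1 != 0 -> c 0 0 != c 0 1 ->
  c 0 0 ^+ 2 * c 0 1 != 1 -> c 0 0 * c 0 1 ^+ 2 != 1 ->
  has_deriv A c dA -> has_deriv B c dB -> deriv_near A c -> deriv_near B c ->
  A c = 0 -> B c = 0 -> Q.[c 0 2] != 0 ->
  (forall v, dA v = 0 -> dB v = 0 -> v 0 2 = 0 -> v = 0) ->
  (\forall x \near c,
     F (tau x) = A x * B x + (x 0 2 - c 0 2) ^+ nu.+1 * Q.[x 0 2]) ->
  analytically_equivalent F (tau c) (A_normal_form nu) 0.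
Proof.
move=> s0 t0 st st1 st2 dAc dBc nA nB A0 B0 Q0 inj FE.
have [Lt [tL tu tn]] := tau_chart s0 t0 st st1 st2.
have [i i2] : exists i : C, i ^+ 2 = -1.
  by exists ('i%C : R[i]); apply: sqr_i.
have two0 : 2 != 0 :> C by rewrite pnatr_eq0.
have i0 : i != 0.
  by apply/eqP => i0; move/eqP: i2; rewrite i0 expr0n /= eq_sym oppr_eq0 oner_eq0.
pose h : C := 2^-1; pose h' : C := (2 * i)^-1.
have dz := has_deriv_coord (2 : 'I_3) c.
have nz := deriv_near_coord (2 : 'I_3) c.
have dQ := has_derivV Q0 (has_deriv_horner Q dz).
have nQ := deriv_nearV Q0 (deriv_near_horner Q nz).
have dAQ := has_derivM dAc dQ; have nAQ := deriv_nearM nA nQ.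
have dX := has_derivM (has_derivD dAQ dBc) (has_deriv_const h c).
have dY := has_derivM (has_derivB dAQ dBc) (has_deriv_const h' c).
have dZ := has_derivB dz (has_deriv_const (c 0 2) c).
have nX := deriv_nearM (deriv_nearD nAQ nB) (deriv_near_const h c).
have nY := deriv_nearM (deriv_nearB nAQ nB) (deriv_near_const h' c).
have nZ := deriv_nearB nz (deriv_near_const (c 0 2) c).
have [v|Lk [kL ku kn]] := vec3_chart dX dY dZ nX nY nZ.
  move=> EX EY EZ; set qi := Q.[c 0 2]^-1 in EX EY *.
  have qi0 : qi != 0 by rewrite invr_eq0.
  have /eqP : h * (qi * dA v + dB v) = 0 by rewrite -[RHS]EX A0 B0; ring.
  rewrite mulf_eq0 invr_eq0 (negPf two0) /= => /eqP E1.
  have /eqP : h' * (qi * dA v - dB v) = 0 by rewrite -[RHS]EY A0 B0; ring.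
  rewrite mulf_eq0 invr_eq0 mulf_eq0 (negPf two0) (negPf i0) /= => /eqP E2.
  have dA0 : dA v = 0.
    have /eqP : 2 * qi * dA v = 0 by rewrite -[RHS]addr0 -{1}E1 -E2; ring.
    by rewrite !mulf_eq0 (negPf two0) (negPf qi0) => /eqP.
  apply: inj => //; last by move: EZ; rewrite subr0.
  by move: E1; rewrite dA0 mulr0 add0r.
set kappa := fun x => vec3 _ _ _ in kL kn.
have k0 : kappa c = 0.
  apply/rowP => j; rewrite !mxE A0 B0 !mul0r addr0 !subrr !mul0r.
  by case: ifP => // _; case: ifP.
rewrite -k0; apply: (equivalent_by_charts (u := fun y => Q.[y 0 2 + c 0 2])
   tL tu tn kL ku kn).
- apply: holomorphic_scalar; apply: deriv_near_horner.
  by apply: deriv_nearD; [apply: deriv_near_coord|apply: deriv_near_const].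
- by rewrite k0 mxE add0r.
have := has_deriv_near_neq0 (has_deriv_horner Q dz) Q0.
move: FE; apply: filterS2 => x -> Qx.
rewrite /A_normal_form /kappa !mxE /= subrK /h /h'.
move: (A x) (B x) Q.[x 0 2] (_ ^+ nu.+1) Qx => a b q z q0.
have -> : ((a / q - b) / (2 * i)) ^+ 2 = - ((a / q - b) / 2) ^+ 2.
  by rewrite !expr_div_n exprMn i2; field.
by field.
Qed.

End Nodes.

Section SingularPoints.
Variable R : realType.
Local Notation C := (Cplx R).
Local Notation V := 'rV[C]_3.
Variables (w : C) (g : {poly C}) (d nu : nat).
Hypotheses (w1 : w ^+ 2 + w + 1 = 0) (d0 : (0 < d)%N) (sg : (size g <= d.+1)%N).

Definition surface_form : form4 R := @fold_form R[i] w g d.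

Definition affine_eqn (x : V) : C := evalform surface_form (chart ord_max x).

Let w3 : w ^+ 3 = 1.
Proof.
have : w ^+ 3 - 1 = (w - 1) * (w ^+ 2 + w + 1) by ring.
by rewrite w1 mulr0 => /eqP; rewrite subr_eq0 => /eqP.
Qed.

Let w_neq0 : w != 0.
Proof.
by apply: contra_eq_neq w1 => ->; rewrite expr0n /= !add0r oner_neq0.
Qed.

Let char0 n : n.+1%:R != 0 :> C.
Proof. by rewrite pnatr_eq0. Qed.

Let U (x : V) : C := w * x 0 0 ^+ d.
Let U' (x : V) : C := w * x 0 1 ^+ d.

(** With [U_i = w * u_i ^ d] for [u1 u2 u3 = 1] the product of the [U_i] is [1],
    and the two power sums contribute [U1 + U2 + U3] and
    [1 / U1 + 1 / U2 + 1 / U3]. *)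
Lemma affine_eqn_tau (x : V) : x 0 0 != 0 -> x 0 1 != 0 ->
  affine_eqn (tau x) =
  U x + U' x + (U x * U' x)^-1 + ((U x)^-1 + (U' x)^-1 + U x * U' x) + 2
  + g.[x 0 2].
Proof.
move=> s0 t0; set s := x 0 0; set t := x 0 1.
have st0 : s * t != 0 by rewrite mulf_neq0.
have E j : chart ord_max (tau x) 0 (lift ord_max j) = tau x 0 j.
  by rewrite mxE liftK.
have E1 : chart ord_max (tau x) 0 ord_max = 1 by rewrite mxE unlift_none.
rewrite /affine_eqn /evalform.
have -> := @fold_form_eval R[i] w g d (fun k => chart ord_max (tau x) 0 k) sg E1.
rewrite !E !mxE /= -/s -/t; congr (_ + _ + _).
have p1 := psum_elementary s t (s * t)^-1 d.
have p2 := psum_elementary s^-1 t^-1 (s * t) d.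
have e1 : s * t + s * (s * t)^-1 + t * (s * t)^-1 = s * t + s^-1 + t^-1.
  by field; rewrite s0 t0.
have e2 : s^-1 + t^-1 + s * t = s * t + s^-1 + t^-1 by ring.
have e3 : s^-1 * t^-1 + s^-1 * (s * t) + t^-1 * (s * t) = s + t + (s * t)^-1.
  by field; rewrite s0 t0.
have e4 : s^-1 * t^-1 * (s * t) = 1 by field; rewrite s0 t0.
rewrite e1 mulfV // in p1; rewrite e2 e3 e4 in p2.
rewrite p1 p2 /U /U' -/s -/t !exprVn exprMn.
have sd : s ^+ d != 0 by rewrite expf_neq0.
have td : t ^+ d != 0 by rewrite expf_neq0.
move: (s ^+ d) (t ^+ d) sd td => a b a0 b0.
have wV : w^-1 = w ^+ 2 by apply: (mulfI w_neq0); rewrite mulfV // -exprS w3.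
rewrite !invfM wV; have w4 : w ^+ 2 * w ^+ 2 = w.
  by rewrite -exprD (exprD _ 3 1) w3 mul1r.
have -> : w ^+ 2 / a * (w ^+ 2 / b) = w * (a * b)^-1.
  by rewrite mulrACA w4 invfM.
by rewrite invfM; ring.
Qed.

Let dU c : has_deriv U c (fun v => w * (c 0 0 ^+ d.-1 *+ d) * v 0 0).
Proof.
have := has_derivM (has_deriv_const w c) (has_derivX d (has_deriv_coord (0 : 'I_3) c)).
by move=> /has_deriv_eq; apply=> v; rewrite mulr0 add0r mulrA.
Qed.

Let dU' c : has_deriv U' c (fun v => w * (c 0 1 ^+ d.-1 *+ d) * v 0 1).
Proof.
have := has_derivM (has_deriv_const w c) (has_derivX d (has_deriv_coord (1 : 'I_3) c)).
by move=> /has_deriv_eq; apply=> v; rewrite mulr0 add0r mulrA.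
Qed.

Let nU (c : V) : deriv_near U c.
Proof. exact: deriv_nearM (deriv_near_const w c) (deriv_nearX d (deriv_near_coord _ c)). Qed.

Let nU' (c : V) : deriv_near U' c.
Proof. exact: deriv_nearM (deriv_near_const w c) (deriv_nearX d (deriv_near_coord _ c)). Qed.

Let dU_neq0 (z : C) : z != 0 -> w * (z ^+ d.-1 *+ d) != 0.
Proof.
by move=> z0; rewrite mulf_neq0 // mulrn_eq0 (gtn_eqF d0) expf_neq0.
Qed.

(* The affine equation, f + 2 + g, is the sum of f + 2 + g0 = A * B and of g - g0,
   which is (z - p)^(nu + 1) * Q. *)
Let node (c : V) (A B dA dB : V -> C) (g0 : C) :
  c 0 0 != 0 -> c 0 1 != 0 -> c 0 0 != c 0 1 ->
  c 0 0 ^+ 2 * c 0 1 != 1 -> c 0 0 * c 0 1 ^+ 2 != 1 ->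
  has_deriv A c dA -> has_deriv B c dB -> deriv_near A c -> deriv_near B c ->
  A c = 0 -> B c = 0 ->
  (forall v, dA v = 0 -> dB v = 0 -> v 0 0 = 0 /\ v 0 1 = 0) ->
  (forall x : V, x 0 0 != 0 -> x 0 1 != 0 ->
    affine_eqn (tau x) = A x * B x + (g - g0%:P).[x 0 2]) ->
  exact_root nu.+1 (g - g0%:P) (c 0 2) ->
  analytically_equivalent affine_eqn (tau c) (A_normal_form nu) 0.
Proof.
move=> s0 t0 st st1 st2 dAc dBc nA nB A0 B0 inj E [Q gE Q0].
apply: (node_equivalence s0 t0 st st1 st2 dAc dBc nA nB A0 B0 Q0).
  move=> v a0 b0 v2; have [v00 v10] := inj v a0 b0.
  apply/rowP => j; rewrite mxE; case: j => [[|[|[|//]]]] lt.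
  - by rewrite -[RHS]v00; congr (v _ _); apply: val_inj.
  - by rewrite -[RHS]v10; congr (v _ _); apply: val_inj.
  - by rewrite -[RHS]v2; congr (v _ _); apply: val_inj.
have := has_deriv_near_neq0 (has_deriv_coord (0 : 'I_3) c) s0.
have := has_deriv_near_neq0 (has_deriv_coord (1 : 'I_3) c) t0.
apply: filterS2 => x x1 x0.
by rewrite E // gE hornerM horner_exp hornerXsubC.
Qed.

(** The equation is [A * B + g] for [A = (1 + U1) (1 + U3)] and [B = 1 + U2]. Both
    factors vanish for [U1 = U2 = -1], where [U3 = 1], and their derivatives are
    independent. *)
Lemma black_singular_point (c : V) :
  c 0 0 ^+ d = - w ^+ 2 -> c 0 1 ^+ d = - w ^+ 2 -> c 0 0 != c 0 1 ->
  exact_root nu.+1 g (c 0 2) ->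
  analytically_equivalent affine_eqn (tau c) (A_normal_form nu) 0.
Proof.
move=> sd td st gp.
have wn0 : - w ^+ 2 != 0 by rewrite oppr_eq0 expf_neq0.
have s0 : c 0 0 != 0 by apply: contra_neq wn0 => E; rewrite -sd E expr0n gtn_eqF.
have t0 : c 0 1 != 0 by apply: contra_neq wn0 => E; rewrite -td E expr0n gtn_eqF.
have Uc : U c = -1 by rewrite /U sd mulrN -exprS w3.
have U'c : U' c = -1 by rewrite /U' td mulrN -exprS w3.
have UU0 : U c * U' c != 0 by rewrite Uc U'c mulN1r opprK oner_neq0.
have cube : (- w ^+ 2) ^+ 3 != 1.
  rewrite exprNn -exprM (exprM _ 3 2) w3 expr1n mulr1 -subr_eq0 -signr_odd expr1.
  by rewrite -opprD oppr_eq0; exact: (char0 1).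
have st1 : c 0 0 ^+ 2 * c 0 1 != 1.
  apply: contraNneq cube => E.
  by rewrite [_ ^+ 3]exprSr -{1}sd -{1}td -exprAC -exprMn E expr1n.
have st2 : c 0 0 * c 0 1 ^+ 2 != 1.
  apply: contraNneq cube => E.
  by rewrite exprS -{1}sd -{1}td -exprAC -exprMn E expr1n.
have dA := has_derivM (has_derivD (has_deriv_const 1 c) (dU c))
  (has_derivD (has_deriv_const 1 c) (has_derivV UU0 (has_derivM (dU c) (dU' c)))).
have dB := has_derivD (has_deriv_const 1 c) (dU' c).
have nA := deriv_nearM (deriv_nearD (deriv_near_const 1 c) (nU c))
  (deriv_nearD (deriv_near_const 1 c) (deriv_nearV UU0 (deriv_nearM (nU c) (nU' c)))).
have nB := deriv_nearD (deriv_near_const 1 c) (nU' c).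
apply: (node s0 t0 st st1 st2 dA dB nA nB (g0 := 0)); last by rewrite subr0.
- by rewrite Uc subrr mul0r.
- by rewrite U'c subrr.
- move=> v; rewrite Uc U'c => EA EB.
  have v1 : v 0 1 = 0.
    by move/eqP: EB; rewrite add0r mulf_eq0 (negPf (dU_neq0 t0)) => /eqP.
  split=> //; have /eqP : 2 * (w * (c 0 0 ^+ d.-1 *+ d) * v 0 0) = 0.
    by rewrite -[RHS]EA; field.
  by rewrite mulf_eq0 (negPf (char0 1)) mulf_eq0 (negPf (dU_neq0 s0)) => /eqP.
move=> x x0 x1; rewrite affine_eqn_tau // subr0; congr (_ + _).
have : U x != 0 by rewrite mulf_neq0 ?expf_neq0.
have : U' x != 0 by rewrite mulf_neq0 ?expf_neq0.
by move: (U x) (U' x) => a b b0 a0; field; rewrite a0 b0.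
Qed.

(** The equation is [A * B + (g - 1)] for [A = 1 + U1 + U1 U2] and
    [B = 1 + 1 / U1 + 1 / (U1 U2)]. Both factors vanish if [U1 = U2] is a
    primitive cube root of unity, and their derivatives are independent there. *)
Lemma white_singular_point (c : V) (th : C) : th ^+ 2 + th + 1 = 0 ->
  U c = th -> U' c = th -> c 0 0 != 0 -> c 0 1 != 0 -> c 0 0 != c 0 1 ->
  c 0 0 ^+ 2 * c 0 1 != 1 -> c 0 0 * c 0 1 ^+ 2 != 1 ->
  exact_root nu.+1 (g - 1) (c 0 2) ->
  analytically_equivalent affine_eqn (tau c) (A_normal_form nu) 0.
Proof.
move=> th1 Uc U'c s0 t0 st st1 st2 gp.
have th3 : th ^+ 3 = 1.
  have : th ^+ 3 - 1 = (th - 1) * (th ^+ 2 + th + 1) by ring.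
  by rewrite th1 mulr0 => /eqP; rewrite subr_eq0 => /eqP.
have th0 : th != 0.
  by apply: contra_eq_neq th1 => ->; rewrite expr0n /= !add0r oner_neq0.
have thV : th^-1 = th ^+ 2 by apply: (mulfI th0); rewrite mulfV // -exprS th3.
have U0 : U c != 0 by rewrite Uc.
have UU0 : U c * U' c != 0 by rewrite Uc U'c mulf_neq0.
have dA := has_derivD (has_derivD (has_deriv_const 1 c) (dU c))
  (has_derivM (dU c) (dU' c)).
have dB := has_derivD (has_derivD (has_deriv_const 1 c) (has_derivV U0 (dU c)))
  (has_derivV UU0 (has_derivM (dU c) (dU' c))).
have nA := deriv_nearD (deriv_nearD (deriv_near_const 1 c) (nU c))
  (deriv_nearM (nU c) (nU' c)).
have nB := deriv_nearD (deriv_nearD (deriv_near_const 1 c) (deriv_nearV U0 (nU c)))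
  (deriv_nearV UU0 (deriv_nearM (nU c) (nU' c))).
apply: (node s0 t0 st st1 st2 dA dB nA nB (g0 := 1)); last by rewrite polyC1.
- by rewrite Uc U'c -expr2 -[RHS]th1; ring.
- by rewrite Uc U'c invfM thV -[RHS]th1 -exprD (exprD _ 3 1) th3 mul1r; ring.
- move=> v; rewrite Uc U'c; move: (dU_neq0 s0) (dU_neq0 t0).
  set ks := w * (c 0 0 ^+ _ *+ d); set kt := w * (c 0 1 ^+ _ *+ d) => ks0 kt0.
  move=> EA EB; pose a := ks * v 0 0; pose b := kt * v 0 1.
  have {}EA : a + th * a + th * b = 0 by rewrite -[RHS]EA /a /b; ring.
  have {}EB : th * a + a + b = 0.
    by rewrite -(mulr0 (- th ^+ 3)) -EB /a /b; field.
  have th2 : 1 - th ^+ 2 != 0.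
    apply/eqP => th2; have th2' : th ^+ 2 = 1 by apply/esym/eqP; rewrite -subr_eq0 th2.
    have th11 : th = 1 by rewrite -[RHS]th3 exprS th2' mulr1.
    have /eqP := th1; rewrite th11 expr1n; apply/negP.
    by rewrite (_ : 1 + 1 + 1 = 3%:R) ?char0 //; ring.
  have /eqP : (1 - th ^+ 2) * a = 0.
    by rewrite -[RHS](subr0 0) -{1}EA -(mulr0 th) -EB; ring.
  rewrite mulf_eq0 (negPf th2) /= => /eqP a0.
  have b0 : b = 0 by move: EB; rewrite a0 mulr0 !add0r.
  move/eqP: a0; rewrite mulf_eq0 (negPf ks0) => /eqP ->.
  by move/eqP: b0; rewrite mulf_eq0 (negPf kt0) => /eqP ->.
move=> x x0 x1; rewrite affine_eqn_tau // hornerD hornerN hornerC.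
have : U x != 0 by rewrite mulf_neq0 ?expf_neq0.
have : U' x != 0 by rewrite mulf_neq0 ?expf_neq0.
move: (U x) (U' x) g.[_] => a b y b0 a0. by field; rewrite a0 b0.
Qed.

End SingularPoints.

(** * Counting the critical points of the folding polynomial *)

Section ListCounting.

Lemma size_le_fibres (T U : eqType) (f : T -> U) (s : seq T) c :
  (forall x, x \in s -> (count (fun y => f y == f x) s <= c)%N) ->
  (size s <= c * size (undup (map f s)))%N.
Proof.
move=> fc; have E (us : seq U) (r : seq T) : uniq us ->
    {subset map f r <= us} ->
    size r = (\sum_(u <- us) count (fun y => f y == u) r)%N.
  move=> uus; elim: r => [|x r IH] sub; first by rewrite big1.
  rewrite /= big_split /= -IH => [|u ur]; last by apply: sub; rewrite inE ur orbT.
  rewrite (bigD1_seq (f x)) ?sub ?inE ?eqxx //= big1 ?addn0 // => u.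
  by rewrite eq_sym => /negPf ->.
rewrite (E _ _ (undup_uniq (map f s))) => [|u]; last by rewrite mem_undup.
rewrite -sum1_size big_distrr /= big_seq [leqRHS]big_seq.
apply: leq_sum => u; rewrite mem_undup => /mapP [x xs ->].
by rewrite muln1 fc.
Qed.

Lemma uniq_count_le (T : eqType) (P : pred T) (s l : seq T) : uniq s ->
  (forall x, x \in s -> P x -> x \in l) -> (count P s <= size l)%N.
Proof.
move=> us sub; rewrite -size_filter; apply: uniq_leq_size.
  exact: filter_uniq.
by move=> x; rewrite mem_filter => /andP[Px xs]; apply: sub.
Qed.

Lemma size_le_filter (T : eqType) (P : pred T) (s l : seq T) : uniq s ->
  (forall x, x \in s -> ~~ P x -> x \in l) ->
  (size s <= size [seq x <- s | P x] + size l)%N.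
Proof.
move=> us sub; rewrite -(count_predC P s) size_filter leq_add2l.
exact: uniq_count_le.
Qed.

Lemma counting_ge (T : choiceType) (R : realType) (X : set T) (s : seq T) :
  uniq s -> (forall x, x \in s -> X x) ->
  ((size s)%:R%:E <= counting X :> \bar R)%E.
Proof.
move=> us sX; rewrite /counting; case: asboolP => [fX|_]; last exact: leey.
rewrite lee_fin ler_nat; have <- : #|` [fset x in s]%fset| = size s.
  by rewrite card_fseq undup_id.
apply/fsubset_leq_card/fsubsetP => x; rewrite !inE => /sX Xx.
by rewrite in_fset_set //; apply/mem_set.
Qed.

End ListCounting.

Section Roots.
Variable K : numClosedFieldType.

Lemma nth_roots (c : K) d : c != 0 -> (0 < d)%N ->
  exists s : seq K, [/\ uniq s, size s = d & forall x, (x \in s) = (x ^+ d == c)].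
Proof.
move=> c0 d0; pose p : {poly K} := 'X^d - c%:P.
have [s pE] := closed_field_poly_normal p.
have pm : p \is monic by apply: monicXnsubC.
rewrite (monicP pm) scale1r in pE.
have rE x : (x \in s) = (x ^+ d == c).
  by rewrite -root_prod_XsubC -pE rootE hornerD hornerN hornerXn hornerC subr_eq0.
exists s; split=> //.
  apply: (coprime_root_uniq pE) => x; rewrite pE root_prod_XsubC rE => /eqP xd.
  rewrite -pE derivB derivXn derivC subr0 rootE hornerMn hornerXn mulrn_eq0.
  rewrite gtn_eqF //= expf_eq0; apply/nandP; right.
  by apply: contraNneq c0 => x0; rewrite -xd x0 expr0n gtn_eqF.
have := size_XnsubC c d0; rewrite -/p pE size_prod_XsubC => -[].
by [].
Qed.

Lemma cube_root_of_unity : exists w : K, w ^+ 2 + w + 1 = 0.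
Proof.
have /closed_rootP [w] : size ('X^2 + 'X + 1 : {poly K}) != 1%N.
  rewrite -addrA size_polyDl ?size_polyXn //.
  by rewrite (leq_ltn_trans (size_polyD _ _)) // size_polyX size_poly1.
by rewrite rootE !hornerD hornerXn hornerX hornerC => /eqP wE; exists w.
Qed.

End Roots.

Section TorusPoints.
Variable K : numClosedFieldType.

Definition sym12 (x : K * K) : K * K :=
  (x.1 + x.2 + (x.1 * x.2)^-1, x.1 * x.2 + x.1^-1 + x.2^-1).

(** Equal values of the symmetric functions mean that the two triples
    [(s, t, (s t)^-1)] are roots of the same cubic polynomial. *)
Lemma sym12_root (x y : K * K) : x.1 != 0 -> x.2 != 0 -> y.1 != 0 -> y.2 != 0 ->
  sym12 x = sym12 y ->
  y.1 \in [:: x.1; x.2; (x.1 * x.2)^-1] /\ y.2 \in [:: x.1; x.2; (x.1 * x.2)^-1].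
Proof.
case: x y => [s t] [s' t'] /= s0 t0 s'0 t'0 [e1 e2].
have key z : z ^+ 3 - (s' + t' + (s' * t')^-1) * z ^+ 2
    + (s' * t' + s'^-1 + t'^-1) * z - 1 = 0 -> z \in [:: s; t; (s * t)^-1].
  rewrite -e1 -e2 => zE; have /eqP : (z - s) * (z - t) * (z - (s * t)^-1) = 0.
    by rewrite -[RHS]zE; field; rewrite s0 t0.
  by rewrite !mulf_eq0 !subr_eq0 !inE orbA.
by split; apply: key; field; rewrite s'0 t'0.
Qed.

(* The entries of (s, t, (s t)^-1) are distinct. *)
Definition distinct_triple (x : K * K) :=
  [&& x.1 != x.2, x.1 ^+ 2 * x.2 != 1 & x.1 * x.2 ^+ 2 != 1].

Variables (w : K) (d : nat).
Hypotheses (w1 : w ^+ 2 + w + 1 = 0) (d0 : (0 < d)%N).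

Let w_neq0 : w != 0.
Proof. by apply: contra_eq_neq w1 => ->; rewrite expr0n /= !add0r oner_neq0. Qed.

Let w3 : w ^+ 3 = 1.
Proof.
have : w ^+ 3 - 1 = (w - 1) * (w ^+ 2 + w + 1) by ring.
by rewrite w1 mulr0 => /eqP; rewrite subr_eq0 => /eqP.
Qed.

Let w_neq1 : w != 1.
Proof.
apply: contra_eq_neq w1 => ->; rewrite expr1n.
by rewrite (_ : 1 + 1 + 1 = 3%:R) ?pnatr_eq0 //; ring.
Qed.

Local Notation pairs s := [seq (a, b) | a <- s, b <- s].

Let pairs_uniq (s : seq K) : uniq s -> uniq (pairs s).
Proof. by move=> us; apply: allpairs_uniq => // -[a b] [a' b']. Qed.

Let size_pairs (s : seq K) : size (pairs s) = (size s ^ 2)%N.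
Proof. exact: size_allpairs. Qed.

Let mem_pairs (s : seq K) x : x \in pairs s -> x.1 \in s /\ x.2 \in s.
Proof. by move=> /allpairsP [[a b] /= [aE bE ->]]. Qed.

(** The pairs of distinct [d]-th roots of [- w ^ 2] give at most two times the
    same value: the third entry [(s t)^-1] of the triple has the [d]-th power
    [w ^ 2], so that only the two orders of the pair are possible. *)
Lemma black_torus_points : exists T : seq (K * K),
  [/\ uniq T, (d ^ 2 <= 2 * size T + d)%N &
  forall u, u \in T -> exists x : K * K,
    [/\ x.1 ^+ d = - w ^+ 2, x.2 ^+ d = - w ^+ 2, x.1 != x.2 & u = sym12 x]].
Proof.
have c0 : - w ^+ 2 != 0 by rewrite oppr_eq0 expf_neq0.
have [E [uE sE ME]] := nth_roots c0 d0.
have nz x : x \in E -> x != 0.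
  by rewrite ME => /eqP E1; apply: contra_neq c0 => x0; rewrite -E1 x0 expr0n gtn_eqF.
pose S := [seq x <- pairs E | x.1 != x.2].
have SP x : x \in S -> [/\ x.1 \in E, x.2 \in E & x.1 != x.2].
  by rewrite mem_filter => /andP [xn /mem_pairs []].
have sS : (d ^ 2 <= size S + d)%N.
  rewrite -sE -size_pairs -(size_map (fun a => (a, a)) E).
  apply: size_le_filter; first exact: pairs_uniq.
  move=> [a b] /mem_pairs [/= aE bE]; rewrite negbK => /eqP <-.
  by apply/mapP; exists a.
exists (undup (map sym12 S)); split; first exact: undup_uniq.
  apply: leq_trans sS _; rewrite leq_add2r; apply: size_le_fibres => x xS.
  have -> : 2%N = size [:: x; (x.2, x.1)] by [].
  apply: uniq_count_le; first exact/filter_uniq/pairs_uniq.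
  move=> y yS /eqP yx; have [x1 x2 xn] := SP x xS; have [y1 y2 yn] := SP y yS.
  have [] := sym12_root (nz _ x1) (nz _ x2) (nz _ y1) (nz _ y2) (esym yx).
  have third z : z \in E -> z != (x.1 * x.2)^-1.
    rewrite ME => /eqP zd; apply: contra_eq_neq zd => ->.
    move: x1 x2; rewrite !ME exprVn exprMn => /eqP -> /eqP ->.
    rewrite mulrNN -exprD (exprD _ 3 1) w3 mul1r -subr_eq0 opprK.
    have -> : w^-1 = w ^+ 2 by apply: (mulfI w_neq0); rewrite mulfV // -exprS w3.
    by rewrite -mulr2n mulrn_eq0 /= expf_neq0.
  rewrite !inE (negPf (third _ y1)) (negPf (third _ y2)) !orbF.
  case: x y yn {xS yS yx xn y1 y2 x1 x2 third} => [s t] [s' t'] /= yn.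
  case/orP=> /eqP e1; case/orP=> /eqP e2; rewrite e1 e2 in yn *;
    by rewrite ?eqxx ?orbT // in yn *.
move=> u; rewrite mem_undup => /mapP [x /SP [x1 x2 xn] ->]; exists x.
by rewrite !ME in x1 x2; split=> //; apply/eqP.
Qed.

(* The pairs left out are among (a, a), (a, a^-2) and (a^-2, a), which coincide for
   a^3 = 1. *)
Let size_good (s : seq K) : uniq s -> (forall x, x \in s -> x != 0) ->
  (size s ^ 2 <= size [seq x <- pairs s | distinct_triple x]
    + (size s + 2 * count (fun a => a ^+ 3 != 1)%R s))%N.
Proof.
move=> us nz; rewrite -size_pairs; set r := [seq a <- s | a ^+ 3 != 1].
have -> : (size s + 2 * count (fun a => a ^+ 3 != 1)%R s)%N =
    size ([seq (a, a) | a <- s] ++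
      [seq (a, a ^- 2) | a <- r] ++ [seq (a ^- 2, a) | a <- r]).
  by rewrite !size_cat !size_map size_filter addnn mul2n.
apply: size_le_filter; first exact: pairs_uniq.
move=> [a b] /mem_pairs [/= aE bE].
have diag : a = b -> (a, b) \in [seq (a, a) | a <- s].
  by move=> <-; apply/mapP; exists a.
rewrite !mem_cat /distinct_triple /= !negb_and !negbK.
have [/diag -> //|/eqP ab /=] := eqVneq a b.
case/orP=> /eqP E.
  have b2 : b = a ^- 2.
    by rewrite -[LHS](mulKf (expf_neq0 2 (nz a aE))) E mulr1.
  apply/orP; right; apply/orP; left; rewrite b2; apply: map_f.
  rewrite mem_filter aE andbT; apply/eqP => a3; apply: ab.
  by rewrite -[LHS](mulKf (expf_neq0 2 (nz a aE))) -exprSr a3 mulr1.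
have a2 : a = b ^- 2.
  by rewrite -[LHS](mulfK (expf_neq0 2 (nz b bE))) E mul1r.
apply/orP; right; apply/orP; right; rewrite a2; apply: (map_f (fun a => (a ^- 2, a))).
rewrite mem_filter bE andbT; apply/eqP => b3; apply: ab.
by rewrite a2 -[RHS](mulKf (expf_neq0 2 (nz b bE))) -exprSr b3 mulr1.
Qed.

(** The triples of distinct entries come from the pairs of [d]-th roots of [1],
    with [th = w], and of [w], with [th = w ^ 2]; six of them may give the same
    value. Among the [d]-th roots of [1] are the three cube roots of unity, as
    [3] divides [d], so that only [3 d - 6] pairs of [d]-th roots of [1] are left
    out, and at most [3 d] pairs of [d]-th roots of [w]. *)
Lemma white_torus_points : (3 %| d)%N -> exists T : seq (K * K),
  [/\ uniq T, (2 * d ^ 2 + 6 <= 6 * size T + 6 * d)%N &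
  forall u, u \in T -> exists (x : K * K) (th : K),
    [/\ [/\ th ^+ 2 + th + 1 = 0, w * x.1 ^+ d = th & w * x.2 ^+ d = th],
      x.1 != 0 /\ x.2 != 0, distinct_triple x & u = sym12 x]].
Proof.
move=> d3; have [M [uM sM MM]] := nth_roots (oner_neq0 K) d0.
have [N [uN sN MN]] := nth_roots w_neq0 d0.
have nzM x : x \in M -> x != 0.
  rewrite MM => /eqP E1; apply: contra_eq_neq E1 => ->.
  by rewrite expr0n gtn_eqF // eq_sym oner_neq0.
have nzN x : x \in N -> x != 0.
  rewrite MN => /eqP E1; apply: contra_eq_neq E1 => ->.
  by rewrite expr0n gtn_eqF // eq_sym.
have gM := size_good uM nzM; have gN := size_good uN nzN.
have M3 : (count (fun a => a ^+ 3 != 1)%R M + 3 <= d)%N.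
  rewrite -sM -(count_predC (fun a => a ^+ 3 != 1)%R M) leq_add2l.
  have -> : 3%N = size [:: 1; w; w ^+ 2] by [].
  rewrite -size_filter; apply: uniq_leq_size.
    have w21 : w ^+ 2 != 1.
      by apply: contra_neq w_neq1 => w2; rewrite -[RHS]w3 exprS w2 mulr1.
    have w2w : w ^+ 2 != w.
      by apply: contra_neq w_neq1 => w2; apply: (mulfI w_neq0); rewrite mulr1.
    by rewrite /= !inE !negb_or !(eq_sym 1) w_neq1 w21 eq_sym w2w.
  have wd e : (w ^+ e) ^+ d = 1.
    by rewrite -(divnK d3) mulnC exprM (exprAC w e 3) w3 !expr1n.
  move=> x; rewrite !inE mem_filter /= negbK MM => /or3P [] /eqP ->.
  - by rewrite !expr1n eqxx.
  - by rewrite w3 -[w]expr1 wd eqxx.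
  - by rewrite wd (exprAC w 2 3) w3 expr1n eqxx.
have N3 : (count (fun a => a ^+ 3 != 1)%R N <= d)%N by rewrite -sN count_size.
pose S := [seq x <- pairs M | distinct_triple x] ++ [seq x <- pairs N | distinct_triple x].
have SP x : x \in S -> (x.1 \in M /\ x.2 \in M \/ x.1 \in N /\ x.2 \in N) /\ distinct_triple x.
  by rewrite mem_cat !mem_filter => /orP [] /andP [-> /mem_pairs] mp; split=> //; [left|right].
have nzS x : x \in S -> x.1 != 0 /\ x.2 != 0.
  by move=> /SP [xMN _]; case: xMN => -[x1 x2]; split; by [apply: nzM|apply: nzN].
have uS : uniq S.
  rewrite cat_uniq !filter_uniq ?pairs_uniq //= andbT.
  apply/hasPn => x; rewrite !mem_filter => /andP [_ /mem_pairs [xN _]].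
  apply/negP => /andP [_ /mem_pairs [+ _]]; move: xN; rewrite MM MN => /eqP ->.
  exact/negP.
exists (undup (map sym12 S)); split; first exact: undup_uniq.
  have : (size S <= 6 * size (undup (map sym12 S)))%N.
    apply: size_le_fibres => x xS; have [x1 x2] := nzS x xS.
    set u := (x.1 * x.2)^-1.
    have -> : 6%N = size [:: (x.1, x.2); (x.1, u); (x.2, x.1); (x.2, u);
      (u, x.1); (u, x.2)] by [].
    apply: uniq_count_le => // y yS /eqP yx; have [y1 y2] := nzS y yS.
    have [_ /andP [yn _]] := SP y yS.
    have [] := sym12_root x1 x2 y1 y2 (esym yx).
    case: y yn {yS yx y1 y2} => [s t] /= yn; rewrite -/u !inE !xpair_eqE.
    case/or3P=> /eqP e1; case/or3P=> /eqP e2; rewrite e1 e2 in yn *;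
      by [rewrite !eqxx ?orbT|rewrite eqxx in yn].
  rewrite size_cat; move: gM gN M3 N3; rewrite sM sN -!mulnn.
  move: (size _) (size _) (size _) (count _ M) (count _ N) (d * d)%N => a b c e f dd; lia.
move=> u; rewrite mem_undup => /mapP [x xS ->]; have [xMN gx] := SP x xS.
have n0 := nzS x xS; case: xMN => [] [].
  rewrite !MM => /eqP x1 /eqP x2; exists x, w; split=> //; split=> //.
    by rewrite x1 mulr1.
  by rewrite x2 mulr1.
rewrite !MN => /eqP x1 /eqP x2; exists x, (w ^+ 2).
split=> //; rewrite ?x1 ?x2 -?expr2 //; split=> //.
by rewrite -exprM (exprD _ 3 1) w3 mul1r addrC addrA -w1; ring.
Qed.

End TorusPoints.

(** * The surface and its singular points *)

Lemma Cplx_uncountable (R : realType) : ~ countable [set: R[i]].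
Proof.
move=> cC; have cR : countable [set: R].
  have -> : [set: R] = @complex.Re R @` [set: R[i]].
    by apply/seteqP; split=> // r _; exists (r%:C)%C.
  by apply: card_le_trans cC; apply: card_image_le.
have := countable_lebesgue_measure0 cR.
rewrite -[setT]set_itvNyy lebesgue_measure_itv /=.
by [].
Qed.

Section Surface.
Variable R : realType.
Local Notation C := (Cplx R).
Local Notation V := 'rV[C]_3.

Let chart_dim (a : V) : \dim <[chart ord_max a]>%VS == 1%N.
Proof.
rewrite dim_vline eqb1; apply/eqP => /rowP /(_ ord_max) /eqP.
by rewrite !mxE unlift_none oner_eq0.
Qed.

Definition affine_point (a : V) : proj3 R :=
  exist (fun L : {vspace 'rV[C]_4} => \dim L == 1%N) _ (chart_dim a).

Lemma affine_point_inj : injective affine_point.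
Proof.
move=> a b /(congr1 val) /= E.
have : chart ord_max a \in <[chart ord_max b]>%VS by rewrite -E memv_line.
case/vlineP => k kE.
have k1 : k = 1.
  by move/rowP: (kE) => /(_ ord_max); rewrite !mxE unlift_none mulr1 => <-.
apply/rowP => j; move/rowP: kE => /(_ (lift ord_max j)).
by rewrite !mxE liftK k1 mul1r.
Qed.

Lemma tau_vec3 (x : C * C) p :
  tau (vec3 x.1 x.2 p) = vec3 (sym12 x).1 (sym12 x).2 p.
Proof. by rewrite /tau !mxE. Qed.

Lemma vec3_inj (x y : C * C) (p q : C) :
  vec3 x.1 x.2 p = vec3 y.1 y.2 q -> x = y /\ p = q.
Proof.
move=> /rowP E; have := E 0; have := E 1; have := E 2; rewrite !mxE /= => -> e1 e0.
by split=> //; case: x y e0 e1 {E} => [a b] [a' b'] /= -> ->.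
Qed.

Variables (w : C) (g : {poly C}) (d nu : nat).
Hypotheses (w1 : w ^+ 2 + w + 1 = 0) (d0 : (0 < d)%N) (sg : (size g <= d.+1)%N).

Let w_neq0 : w != 0.
Proof. by apply: contra_eq_neq w1 => ->; rewrite expr0n /= !add0r oner_neq0. Qed.

Lemma surface_surface_form : surface d (surface_form w g d).
Proof.
split; first exact: (@fold_form_neq0 R[i]).
  exact: (@fold_form_homog R[i]).
move=> p q; exact: (@fold_form_squarefree R[i]).
Qed.

Variables (Tb Tw : seq (C * C)) (ps zs : seq C).
Hypotheses (uTb : uniq Tb) (uTw : uniq Tw) (ups : uniq ps) (uzs : uniq zs).
Hypothesis TbP : forall u, u \in Tb -> exists x : C * C,
    [/\ x.1 ^+ d = - w ^+ 2, x.2 ^+ d = - w ^+ 2, x.1 != x.2 & u = sym12 x].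
Hypothesis TwP : forall u, u \in Tw -> exists (x : C * C) (th : C),
    [/\ [/\ th ^+ 2 + th + 1 = 0, w * x.1 ^+ d = th & w * x.2 ^+ d = th],
      x.1 != 0 /\ x.2 != 0, distinct_triple x & u = sym12 x].
Hypothesis psP : forall p, p \in ps -> exact_root nu.+1 g p.
Hypothesis zsP : forall z, z \in zs -> exact_root nu.+1 (g - 1) z.

Let level (u : C * C) := affine_eqn w g d (vec3 u.1 u.2 0) - g.[0].

(* The folding polynomial has the value -2 on Tb and -3 on Tw. *)
Let Tb_Tw u : u \in Tb -> u \in Tw -> False.
Proof.
move=> /TbP [x [x1 x2 xn ux]] /TwP [y [th [[th1 y1 y2] [y10 y20] yn uy]]].
have w3 : w ^+ 3 = 1.
  have : w ^+ 3 - 1 = (w - 1) * (w ^+ 2 + w + 1) by ring.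
  by rewrite w1 mulr0 => /eqP; rewrite subr_eq0 => /eqP.
have wn0 : - w ^+ 2 != 0 by rewrite oppr_eq0 expf_neq0.
have x10 : x.1 != 0 by apply: contra_neq wn0 => E; rewrite -x1 E expr0n gtn_eqF.
have x20 : x.2 != 0 by apply: contra_neq wn0 => E; rewrite -x2 E expr0n gtn_eqF.
have E1 : level u = 0.
  rewrite /level ux -tau_vec3 affine_eqn_tau ?mxE //= x1 x2 mulrN -exprS w3.
  by rewrite invrN1 mulrNN mulr1 invr1; ring.
have E2 : level u = -1.
  have th0 : th != 0.
    by apply: contra_eq_neq th1 => ->; rewrite expr0n /= !add0r oner_neq0.
  rewrite /level uy -tau_vec3 affine_eqn_tau ?mxE //= y1 y2.
  have thE : th ^+ 2 = - th - 1 by rewrite -[LHS]subr0 -th1; ring.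
  have thV : th^-1 = - th - 1.
    by apply: (mulfI th0); rewrite mulfV // mulrBr mulrN -expr2 thE; ring.
  by rewrite invfM -expr2 thV -expr2; ring: thE.
by move: E1; rewrite E2 => /eqP; rewrite oppr_eq0 oner_eq0.
Qed.

Lemma counting_surface_form :
  ((size Tb * size ps + size Tw * size zs)%N%:R%:E <=
   counting (A_singularities nu (surface_form w g d)) :> \bar R)%E.
Proof.
pose pt (a : (C * C) * C) := affine_point (vec3 a.1.1 a.1.2 a.2).
pose L := [seq (u, p) | u <- Tb, p <- ps] ++ [seq (u, p) | u <- Tw, p <- zs].
have <- : size (map pt L) = (size Tb * size ps + size Tw * size zs)%N.
  by rewrite size_map size_cat !size_allpairs.
apply: counting_ge.
  rewrite map_inj_uniq; last first.
    by move=> [u p] [v q] /affine_point_inj /= /vec3_inj [-> ->].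
  rewrite cat_uniq !allpairs_uniq //=; [|by move=> [? ?] [? ?]..].
  rewrite andbT; apply/hasPn => _ /allpairsP [[u p] /= [uT _ ->]].
  apply/negP => /allpairsP [[v q] /= [vT _ E]].
  by case: E uT => -> _ uT; exact: Tb_Tw vT uT.
move=> _ /mapP [[u p] uL ->]; exists ord_max, (vec3 u.1 u.2 p); split=> //.
rewrite -[fun x => _]/(affine_eqn w g d).
move: uL; rewrite mem_cat => /orP [] /allpairsP [[v q] /= [vT qs [-> ->]]].
  have [x [x1 x2 xn ->]] := TbP vT; rewrite -tau_vec3.
  by apply: (black_singular_point w1 d0 sg); rewrite ?mxE //=; apply: psP.
have [x [th [[th1 x1 x2] [x10 x20] /and3P [xn xn1 xn2] ->]]] := TwP vT.
rewrite -tau_vec3.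
by apply: (white_singular_point w1 d0 sg th1); rewrite ?mxE //=; apply: zsP.
Qed.

End Surface.

(** * The bound *)

Theorem mainTheorem2 (R : realType) (q d nu : nat)
    (hq : (0 < q)%N) (hd : d = (3 * q)%N) (hnu : (1 <= nu)%N) :
  (((d%:R * (d%:R + 3) / 6 - 1) * (d %/ nu.+1)%:R
    + (d%:R * (d%:R - 3) / 3 + 1) * ((d - 1) %/ nu)%:R : R)%:E
   <= mu_A R nu d)%E.
Proof.
have d0 : (0 < d)%N by rewrite hd muln_gt0 hq.
have d3 : (3 %| d)%N by rewrite hd dvdn_mulr.
have [w w1] := cube_root_of_unity R[i].
have [g [ps [zs [sg [ups sps] [uzs szs] psP zsP]]]] :=
  two_value_polynomial (@Cplx_uncountable R) hnu d0.
have [Tb [uTb sTb TbP]] := black_torus_points w1 d0.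
have [Tw [uTw sTw TwP]] := white_torus_points w1 d0 d3.
have count := @counting_surface_form R w g d nu w1 d0 sg Tb Tw ps zs uTb uTw ups uzs
  TbP TwP psP zsP.
have Sf := @surface_surface_form R w g d w1 d0.
apply: (@le_trans _ _ (counting (A_singularities nu (surface_form w g d)))); last first.
  by apply: ereal_sup_ubound; exists (surface_form w g d).
apply: le_trans count; rewrite lee_fin natrD !natrM sps -szs natrD.
have Ha : d%:R ^+ 2 <= 2 * (size Tb)%:R + d%:R :> R.
  by rewrite -natrX -natrM -natrD ler_nat.
have Hb : 2 * d%:R ^+ 2 + 6 <= 6 * (size Tw)%:R + 6 * d%:R :> R.
  by rewrite -natrX -!natrM -!natrD ler_nat.
move: Ha Hb; set D := d%:R; set k := (d %/ nu.+1)%:R; set m := (size zs)%:R.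
set a := (size Tb)%:R; set b := (size Tw)%:R => Ha Hb.
have k0 : 0 <= k :> R := ler0n _ _; have m0 : 0 <= m :> R := ler0n _ _.
have : 0 <= k * (2 * a + D - D ^+ 2) by rewrite mulr_ge0 // subr_ge0.
have : 0 <= m * (6 * b + 6 * D - (2 * D ^+ 2 + 6)) by rewrite mulr_ge0 // subr_ge0.
clear; lra.
Qed.
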